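(* Let $f,g_1,\ldots,g_m\in\mathbb{R}[\mathbf{x}]=\mathbb{R}[x_1,\ldots,x_n]$ and let $\mathbf{K}:=\{\mathbf{x}\in\mathbb{R}^n : g_j(\mathbf{x})\ge 0,\ j=1,\ldots,m\}$ be compact. Assume that for some $M>0$ there are sums of squares polynomials $\sigma_0,\ldots,\sigma_m\in\Sigma[\mathbf{x}]$ such that $M-\Vert\mathbf{x}\Vert^2=\sigma_0+\sum_{j=1}^m\sigma_j\,g_j$. Fix $k\in\{1,\ldots,n\}$, and let the interval $\mathbf{Y}_k=[\underline{x}_k,\overline{x}_k]\subset\mathbb{R}$ (with $\underline{x}_k<\overline{x}_k$) be the orthogonal projection of $\mathbf{K}$ onto the $x_k$-coordinate axis. Let $\varphi_k$ be the probability measure uniformly distributed on $\mathbf{Y}_k$. Assume that $\mathbf{K}_y:=\{\mathbf{x}\in\mathbf{K}: x_k=y\}$ is nonempty for every $y\in\mathbf{Y}_k$, and let $J^k(y):=\min\{f(\mathbf{x}):\mathbf{x}\in\mathbf{K}_y\}$ for $y\in\mathbf{Y}_k$. Let $\rho_{ik}$ and $\rho_{ik}^*$ ($i\ge i_0$) be the optimal values of the primal and dual semidefinite relaxations defined in the context. Then: (a) As $i\to\infty$, $\rho_{ik}\uparrow\int_{\mathbf{Y}_k}J^k\,d\varphi_k$ and $\rho_{ik}^*\uparrow\int_{\mathbf{Y}_k}J^k\,d\varphi_k$ (that is, both sequences are nondecreasing in $i$ and converge to this limit). (b) Let $i_1\ge i_0$ be such that the dual relaxation is feasible for all $i\ge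 i_1$, and for each $i\ge i_1$ let $(p_i,(\sigma_j^i)_{j=0}^m)$ be a nearly optimal solution of the dual relaxation of order $i$, i.e. a feasible solution with $\int_{\mathbf{Y}_k}p_i\,d\varphi_k\ge\rho_{ik}^*-1/i$. Then $p_i(y)\le J^k(y)$ for all $y\in\mathbf{Y}_k$, and $$\int_{\mathbf{Y}_k}\vert J^k(y)-p_i(y)\vert\,d\varphi_k(y)\to 0\quad\text{as } i\to\infty.$$ Moreover, if one defines $\tilde p_{i_1}:=p_{i_1}$ and $\tilde p_i(y):=\max[\tilde p_{i-1}(y),p_i(y)]$ for $i>i_1$, then $\tilde p_i(y)\uparrow J^k(y)$ for $\varphi_k$-almost all $y\in\mathbf{Y}_k$, and so $\tilde p_i\to J^k$ $\varphi_k$-almost uniformly on $\mathbf{Y}_k$.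
   Context: Notation: $\Sigma[\mathbf{x}]\subset\mathbb{R}[\mathbf{x}]$ is the set of polynomials that are sums of squares of polynomials; $\mathbb{R}[x_k]_{2i}$ is the space of univariate polynomials in $x_k$ of degree at most $2i$; $\mathbb{N}^n_i:=\{\alpha\in\mathbb{N}^n:\vert\alpha\vert\le i\}$ with $\vert\alpha\vert=\sum_s\alpha_s$; $A\succeq0$ means that the real symmetric matrix $A$ is positive semidefinite. For a real sequence $\mathbf{z}=(z_\alpha)_{\alpha\in\mathbb{N}^n_{2i}}$, let $L_{\mathbf{z}}$ be the linear functional $L_{\mathbf{z}}(\sum_\alpha h_\alpha\mathbf{x}^\alpha):=\sum_\alpha h_\alpha z_\alpha$ on polynomials of degree at most $2i$. The moment matrix $\mathbf{M}_i(\mathbf{z})$ has rows and columns indexed by $\mathbb{N}^n_i$ and entries $\mathbf{M}_i(\mathbf{z})(\alpha,\beta)=L_{\mathbf{z}}(\mathbf{x}^{\alpha+\beta})=z_{\alpha+\beta}$. For $q=\sum_u q_u\mathbf{x}^u\in\mathbb{R}[\mathbf{x}]$ the localizing matrix $\mathbf{M}_r(q\,\mathbf{z})$ has rows and columns indexed by $\mathbb{N}^n_r$ and entries $\mathbf{M}_r(q\,\mathbf{z})(\alpha,\beta)=L_{\mathbf{z}}(q(\mathbf{x})\mathbf{x}^{\alpha+\beta})=\sum_u q_u z_{\alpha+\beta+u}$. Let $v_j:=\lceil(\deg g_j)/2\rceil$ for $j=1,\ldots,m$, and let $i_0\ge1$ be an integer with $i_0\ge\max_j v_j$ and $2i_0\ge\deg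 f$. Let $\beta_\ell:=\int_{\mathbf{Y}_k}x^\ell\,d\varphi_k(x)=\dfrac{\overline{x}_k^{\ell+1}-\underline{x}_k^{\ell+1}}{(\ell+1)(\overline{x}_k-\underline{x}_k)}$, $\ell=0,1,\ldots$, be the moments of $\varphi_k$. Primal relaxation of order $i\ge i_0$: $\rho_{ik}$ is the infimum of $L_{\mathbf{z}}(f)$ over all $\mathbf{z}=(z_\alpha)_{\alpha\in\mathbb{N}^n_{2i}}$ such that $\mathbf{M}_i(\mathbf{z})\succeq0$, $\mathbf{M}_{i-v_j}(g_j\,\mathbf{z})\succeq0$ for $j=1,\ldots,m$, and $L_{\mathbf{z}}(x_k^\ell)=\beta_\ell$ for $\ell=0,1,\ldots,2i$. Dual relaxation of order $i\ge i_0$: with $g_0\equiv1$, $\rho_{ik}^*$ is the supremum of $\int_{\mathbf{Y}_k}p\,d\varphi_k$ over all $(p,(\sigma_j)_{j=0}^m)$ with $p\in\mathbb{R}[x_k]_{2i}$, $\sigma_j\in\Sigma[\mathbf{x}]$ and $\deg(\sigma_jg_j)\le2i$ for $0\le j\le m$, such that $f-p=\sigma_0+\sum_{j=1}^m\sigma_j\,g_j$ (with the convention $\rho_{ik}^*=-\infty$ if there is no feasible solution). A sequence of measurable functions $(h_i)$ on $\mathbf{Y}_k$ converges to $h$ $\varphi_k$-almost uniformly if for every $\epsilon>0$ there is a Borel set $A\subset\mathbf{Y}_k$ with $\varphi_k(A)<\epsilon$ such that $h_i\to h$ uniformly on $\mathbf{Y}_k\setminus A$. *)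

(* Defs.v *)
(* mpoly must be imported before the analysis files: in the other order their
   notations clash. *)
From HB Require Import structures.
From mathcomp Require Import all_boot all_order all_algebra.
From mathcomp Require Import mpoly.
From mathcomp Require Import all_classical all_reals all_analysis.

Set Implicit Arguments.
Unset Strict Implicit.
Unset Printing Implicit Defensive.

Import Order.TTheory GRing.Theory Num.Theory.
Import numFieldNormedType.Exports.

Local Open Scope classical_set_scope.
Local Open Scope ring_scope.

Definition psdmx (R : realType) (N : nat) (A : 'M[R]_N) : Prop :=
  A^T = A /\ forall u : 'cV[R]_N, 0 <= (u^T *m A *m u) ord0 ord0.

(* The least element of [S] when it exists, and 0 otherwise. *)
Definition set_min (R : realType) (S : set R) : R := xget 0 (S `&` lbound S).

Definition almost_uniform_cvg d (T : measurableType d) (R : realType)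
    (mu : set T -> \bar R) (D : set T) (h : nat -> T -> R) (l : T -> R) : Prop :=
  forall eps : R, 0 < eps -> exists A : set T,
    [/\ measurable A, A `<=` D, (mu A < eps%:E)%E
      & {uniform D `\` A, h @ \oo --> l}].

(* [msize p] is 1 + deg p; the degree of the zero polynomial is taken to be 0. *)
Definition mdegree (n : nat) (R : realType) (p : {mpoly R[n]}) : nat :=
  (msize p).-1.

Definition sos (n : nat) (R : realType) (p : {mpoly R[n]}) : Prop :=
  exists s : seq {mpoly R[n]}, p = \sum_(q <- s) q ^+ 2.

Section SemialgebraicSet.
Context (R : realType) (n m : nat).
Implicit Types (f : {mpoly R[n]}) (g : 'I_m -> {mpoly R[n]}) (k : 'I_n).

Definition semialg g : set 'rV[R]_n :=
  [set x | forall j, 0 <= (g j).@[x ord0]].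

Definition semialg_fiber g k (y : R) : set 'rV[R]_n :=
  semialg g `&` [set x | x ord0 k = y].

Definition fiber_min f g k (y : R) : R :=
  set_min [set f.@[x ord0] | x in semialg_fiber g k y].

End SemialgebraicSet.

(* Square matrices indexed by the exponents of total degree at most [r] are
   given the size #|{: 'X_{1..n < r.+1}}|; [exponent] decodes an index. *)
Definition exponent (n r : nat) (a : 'I_#|{: 'X_{1..n < r.+1}}|) : 'X_{1..n} :=
  bmnm (enum_val a).

Section Moments.
Context (R : realType) (n d : nat) (z : 'X_{1..n < d.+1} -> R).

(* Intended for polynomials of degree at most [d]; the monomials of [h] of
   larger degree are ignored. *)
Definition riesz (h : {mpoly R[n]}) : R :=
  \sum_(a : 'X_{1..n < d.+1}) h@_a * z a.

Definition momentmx (r : nat) : 'M[R]_#|{: 'X_{1..n < r.+1}}| :=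
  \matrix_(a, b) riesz 'X_[(exponent a + exponent b)%MM].

Definition localizingmx (r : nat) (q : {mpoly R[n]}) :
    'M[R]_#|{: 'X_{1..n < r.+1}}| :=
  \matrix_(a, b) riesz (q * 'X_[(exponent a + exponent b)%MM]).

End Moments.

(* ceil (deg q / 2) *)
Definition half_degree (n : nat) (R : realType) (q : {mpoly R[n]}) : nat :=
  uphalf (mdegree q).

Section Relaxations.
Context (R : realType) (n m : nat).
Context (f : {mpoly R[n]}) (g : 'I_m -> {mpoly R[n]}) (k : 'I_n).
Context (xl xu : R) (xlu : xl < xu).

Definition uniform_moment (l : nat) : R :=
  \int[uniform_prob xlu]_(x in `[xl, xu]) (x ^+ l).

Definition primal_feasible (i : nat) (z : 'X_{1..n < (2 * i).+1} -> R) : Prop :=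
  [/\ psdmx (momentmx z i),
      forall j, psdmx (localizingmx z (i - half_degree (g j)) (g j))
    & forall l : nat, (l <= 2 * i)%N -> riesz z ('X_k ^+ l) = uniform_moment l].

Definition primal_value (i : nat) : \bar R :=
  ereal_inf [set (riesz z f)%:E | z in primal_feasible (i := i)].

(* [horner_alg 'X_k p] is p(x_k), viewed in R[x_1, ..., x_n]. *)
Definition dual_feasible (i : nat) (p : {poly R})
    (s0 : {mpoly R[n]}) (s : 'I_m -> {mpoly R[n]}) : Prop :=
  [/\ (size p <= (2 * i).+1)%N,
      sos s0 /\ (mdegree s0 <= 2 * i)%N,
      forall j, sos (s j) /\ (mdegree (s j * g j) <= 2 * i)%N
    & f - horner_alg 'X_k p = s0 + \sum_j s j * g j].

Definition uniform_integral (p : {poly R}) : \bar R :=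
  (\int[uniform_prob xlu]_(x in `[xl, xu]) (p.[x])%:E)%E.

Definition dual_value (i : nat) : \bar R :=
  ereal_sup [set uniform_integral p |
             p in [set p | exists s0 s, dual_feasible i p s0 s]].

End Relaxations.

(* For i >= i1 this is the recursion t_{i1} = p_{i1},
   t_i = max (t_{i-1}, p_i); for i < i1 it is padded with p_{i1}. *)
Fixpoint running_max (R : realType) (p : nat -> {poly R}) (i1 i : nat) (y : R)
    : R :=
  if i is j.+1 then
    if (i <= i1)%N then (p i1).[y]
    else Num.max (running_max p i1 j y) (p i).[y]
  else (p i1).[y].

(* Main.v *)
Require Import Defs.
From HB Require Import structures.
From mathcomp Require Import all_boot all_order all_algebra.
From mathcomp Require Import mpoly.
From mathcomp Require Import all_classical all_reals all_analysis.
From mathcomp Require Import measurable_realfun.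
From mathcomp Require Import ring lra zify.
Import Order.TTheory GRing.Theory Num.Theory.
Import numFieldNormedType.Exports.
Local Open Scope classical_set_scope.
Local Open Scope ring_scope.

Set Implicit Arguments.
Unset Strict Implicit.
Unset Printing Implicit Defensive.

(** * Why both hierarchies converge to the integral of J

    Write I for the integral of J over Y against the uniform law.

    Upper bounds.  If p is dual feasible then f - p(x_k) is a combination of 1
    and the g_j with sum of squares coefficients, hence nonnegative on K, and
    evaluating it at a minimiser of f on the fiber over y gives p(y) <= J(y);
    so the dual values are at most I.  For the primal, [mean_functional] builds
    one linear functional L on all polynomials that is nonnegative on the
    polynomials nonnegative on K, has the moments of the uniform law in x_k and
    satisfies L(f) <= I.  It restricts to a feasible point of every relaxation.
    Morally L integrates over a choice of minimisers depending on y.  To get by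
    with finitely many choices at a time, discretise the law: take in each cell
    of a fine partition a point y_t where J hardly exceeds its cell average, put
    the mass of the cell on a minimiser above y_t, and pass to an ultrafilter
    limit as the mesh goes to 0.

    Lower bounds.  On Y the function J is the pointwise limit of its Lipschitz
    minorants J_N(y) = inf over x in K of f(x) + N |y - x_k| ([minorant_cvg]);
    this also shows that J is measurable.  By dominated convergence and
    Bernstein approximation of J_N there is a polynomial p < J on Y with
    integral at least I - e ([poly_below_fiberwise_min]).  Then f - p(x_k) is
    positive on K, and [putinar] provides a certificate for it.  As soon as the
    order exceeds the degrees in this certificate, p is dual feasible and every
    primal feasible functional takes a value at least I - e at f
    ([certificate_eventually]).  Thus both values are squeezed between I - e
    and I.

    Putinar's theorem is derived from the representation theorem for
    archimedean quadratic modules ([archimedean_positivstellensatz]): a maximal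
    proper quadratic module consists of elements on which some algebra
    homomorphism to the reals is nonnegative, and for a polynomial algebra such
    a homomorphism is the evaluation at a point.

    Nearly optimal solutions.  Since p_i <= J, the L1 distance of p_i to J is
    the difference of their integrals, which tends to 0.  The running maxima
    lie between p_i and J, so their monotone limit has the integral of J and
    coincides with J almost everywhere ([ae_cvg_of_integral]); Egorov's theorem
    turns this into almost uniform convergence. *)

(** * Archimedean quadratic modules *)

Section QuadraticModules.
Context {R : realType} {A : comAlgType R}.
Implicit Types (a b f : A) (M Q : set A) (r c : R).

Definition sum_squares (a : A) : Prop :=
  exists s : seq A, a = \sum_(q <- s) q ^+ 2.

Record quadratic_module M : Prop := QuadraticModule {
  qm1 : M 1;
  qmD : forall a b, M a -> M b -> M (a + b);
  qm_sqrM : forall a b, M b -> M (a ^+ 2 * b) }.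

Definition archimedean_set M : Prop := forall a, exists N : nat, M (N%:R - a).

(** R-linearity and alpha 1 = 1 follow from [char_scalar] and [charM]. *)
Record character (alpha : A -> R) : Prop := Character {
  char_scalar : forall c, alpha c%:A = c;
  charD : forall a b, alpha (a + b) = alpha a + alpha b;
  charM : forall a b, alpha (a * b) = alpha a * alpha b }.

Lemma sum_squares0 : sum_squares 0.
Proof. by exists [::]; rewrite big_nil. Qed.

Lemma sum_squaresD a b : sum_squares a -> sum_squares b -> sum_squares (a + b).
Proof. by move=> [s ->] [t ->]; exists (s ++ t); rewrite big_cat. Qed.

Lemma sum_squares_sqrM a b : sum_squares b -> sum_squares (a ^+ 2 * b).
Proof.
move=> [s ->]; exists [seq a * q | q <- s]; rewrite big_map mulr_sumr.
by apply: eq_bigr => q _; rewrite exprMn.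
Qed.

Lemma sum_squares_sqr a : sum_squares (a ^+ 2).
Proof. by exists [:: a]; rewrite big_seq1. Qed.

Section OneModule.
Context {M : set A} (qM : quadratic_module M).

Lemma qm0 : M 0.
Proof. by have := qm_sqrM qM 0 (qm1 qM); rewrite expr0n mul0r. Qed.

Lemma qm_sum (I : Type) (s : seq I) (P : pred I) (F : I -> A) :
  (forall i, P i -> M (F i)) -> M (\sum_(i <- s | P i) F i).
Proof. by move=> MF; apply: (big_ind M) => //; [exact: qm0|exact: qmD]. Qed.

Lemma qmM_sum_squares t a : sum_squares t -> M a -> M (t * a).
Proof.
by move=> [s ->] Ma; rewrite mulr_suml; apply: qm_sum => q _; exact: qm_sqrM.
Qed.

Lemma qm_sum_squares t : sum_squares t -> M t.
Proof. by move=> /qmM_sum_squares-/(_ _ (qm1 qM)); rewrite mulr1. Qed.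

Lemma qmZ c a : 0 <= c -> M a -> M (c *: a).
Proof.
move=> c0 /(qm_sqrM qM (Num.sqrt c)%:A).
by rewrite expr2 -scalerAl mul1r scalerA -expr2 sqr_sqrtr// -scalerAl mul1r.
Qed.

Lemma qm_scalar c : 0 <= c -> M c%:A.
Proof. by move=> c0; apply: qmZ => //; exact: qm1. Qed.

Lemma qm_nat (N : nat) : M N%:R.
Proof. by rewrite -scaler_nat; apply: qm_scalar. Qed.

Lemma qmZ_inv c a : 0 < c -> M (c *: a) -> M a.
Proof.
move=> c0 /(@qmZ c^-1); rewrite invr_ge0 ltW// => /(_ isT).
by rewrite scalerA mulVf ?gt_eqF// scale1r.
Qed.

(** Boundedness passes to squares because of the identity
    2r(r^2 - a^2) = (r - a)^2(r + a) + (r + a)^2(r - a). *)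
Lemma qm_bound_sqr r a :
  0 < r -> M (r%:A - a) -> M (r%:A + a) -> M ((r ^+ 2)%:A - a ^+ 2).
Proof.
move=> r0 Mm Mp; apply: (@qmZ_inv (r + r)); first by rewrite addr_gt0.
have -> : (r + r) *: ((r ^+ 2)%:A - a ^+ 2) =
    (r%:A - a) ^+ 2 * (r%:A + a) + (r%:A + a) ^+ 2 * (r%:A - a) :> A.
  have -> : (r ^+ 2)%:A = r%:A ^+ 2 :> A.
    by rewrite !expr2 -scalerAl mul1r scalerA.
  rewrite -[X in _ *: X = _]mul1r scalerAl scalerDl.
  by set c := r%:A; ring.
by apply: (qmD qM); apply: qm_sqrM.
Qed.

Definition qm_bounded a : Prop := exists N : nat, M (N%:R - a) /\ M (N%:R + a).

Lemma qm_boundedD a b : qm_bounded a -> qm_bounded b -> qm_bounded (a + b).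
Proof.
move=> [N1 [m1 p1]] [N2 [m2 p2]]; exists (N1 + N2)%N; rewrite natrD; split.
- have -> : N1%:R + N2%:R - (a + b) = (N1%:R - a) + (N2%:R - b) by ring.
  exact: qmD.
- have -> : N1%:R + N2%:R + (a + b) = (N1%:R + a) + (N2%:R + b) by ring.
  exact: qmD.
Qed.

Lemma qm_boundedN a : qm_bounded a -> qm_bounded (- a).
Proof. by move=> [N [m p]]; exists N; rewrite opprK. Qed.

Lemma qm_bounded_le N a : M (N%:R - a) -> M (N%:R + a) ->
  forall N', (N <= N')%N -> M (N'%:R - a) /\ M (N'%:R + a).
Proof.
move=> m p N' /subnKC <-; rewrite natrD; split; rewrite addrAC;
  by apply: (qmD qM) => //; exact: qm_nat.
Qed.

Lemma qm_bounded_sqr a : qm_bounded a -> qm_bounded (a ^+ 2).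
Proof.
move=> [N [m p]]; have [m' p'] := @qm_bounded_le _ _ m p N.+1 (leqnSn N).
exists (N.+1 ^ 2)%N; split; last first.
  by apply: (qmD qM); [exact: qm_nat|exact/qm_sum_squares/sum_squares_sqr].
have := @qm_bound_sqr N.+1%:R a (ltr0Sn _ _).
by rewrite -natrX !scaler_nat; apply.
Qed.

Lemma qm_boundedZ c a : qm_bounded a -> qm_bounded (c *: a).
Proof.
wlog c0 : c / 0 <= c.
  move=> H ba; case: (leP 0 c) => c0; first exact: H.
  rewrite -[c]opprK scaleNr; apply: qm_boundedN; apply: H => //.
  by rewrite oppr_ge0 ltW.
move=> [N [m p]]; set N' := Num.bound (c * N%:R).
have N'ge : c * N%:R <= N'%:R by exact/ltW/archi_boundP/mulr_ge0.
have eN : N'%:R = (N'%:R - c * N%:R)%:A + c *: N%:R :> A.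
  by rewrite -(scaler_nat N (1 : A)) scalerA -scalerDl subrK scaler_nat.
have Mr := qm_scalar (_ : 0 <= N'%:R - c * N%:R).
exists N'; rewrite eN -!addrA -scalerBr -scalerDr; split;
  by apply: (qmD qM); [apply: Mr; rewrite subr_ge0|exact: qmZ].
Qed.

Lemma qm_boundedM a b : qm_bounded a -> qm_bounded b -> qm_bounded (a * b).
Proof.
move=> ba bb.
have -> : a * b = 2^-1 *: ((a + b) ^+ 2 - (a ^+ 2 + b ^+ 2)).
  have -> : (a + b) ^+ 2 - (a ^+ 2 + b ^+ 2) = 2%:R *: (a * b).
    by rewrite scaler_nat; ring.
  by rewrite scalerA mulVf ?pnatr_eq0// scale1r.
apply: qm_boundedZ; apply: qm_boundedD; last apply: qm_boundedN.
  by apply/qm_bounded_sqr/qm_boundedD.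
by apply: qm_boundedD; exact: qm_bounded_sqr.
Qed.

Lemma qm_bounded_nat N : qm_bounded N%:R.
Proof. by exists N; rewrite subrr -natrD; split;
  [exact: qm0|exact: qm_nat]. Qed.

(** Completing the square:
    N + 1 + b = (N - b^2) + (b + 1/2)^2 + 3/4. *)
Lemma qm_bounded_of_sqr N a : M (N%:R - a ^+ 2) -> qm_bounded a.
Proof.
move=> MNa; exists N.+1.
suff key b : b ^+ 2 = a ^+ 2 -> M (N.+1%:R + b).
  by split; apply: key; rewrite ?sqrrN.
move=> ba.
have -> : N.+1%:R + b =
    (N%:R - a ^+ 2) + (b + 2^-1%:A) ^+ 2 + (1 - 2^-1 ^+ 2)%:A.
  rewrite sqrrD ba -[b * _]scalerAr mulr1 -[_ *+ 2]scaler_nat scalerA.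
  rewrite mulfV ?pnatr_eq0// scale1r -natr1 [2^-1%:A ^+ 2]expr2 -scalerAl mul1r
    scalerA -expr2.
  rewrite scalerBl scale1r; ring.
apply: (qmD qM); last by apply: qm_scalar; lra.
by apply: (qmD qM) => //; exact/qm_sum_squares/sum_squares_sqr.
Qed.

End OneModule.

Definition adjoin M a : set A :=
  [set x | exists s t, [/\ M s, sum_squares t & x = s + t * a]].

Lemma adjoin_qm M a : quadratic_module M -> quadratic_module (adjoin M a).
Proof.
move=> qM; split.
- exists 1, 0; split; [exact: qm1|exact: sum_squares0|by rewrite mul0r addr0].
- move=> x y [s [t [Ms St ->]]] [s' [t' [Ms' St' ->]]].
  exists (s + s'), (t + t'); split; [exact: qmD|exact: sum_squaresD|].
  by rewrite mulrDl addrACA.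
- move=> q x [s [t [Ms St ->]]]; exists (q ^+ 2 * s), (q ^+ 2 * t).
  split; [exact: qm_sqrM|exact: sum_squares_sqrM|].
  by rewrite mulrDr mulrA.
Qed.

Lemma adjoin_sub M a : M `<=` adjoin M a.
Proof.
move=> s Ms; exists s, 0; rewrite mul0r addr0.
by split=> //; exact: sum_squares0.
Qed.

Lemma adjoin_mem M a : quadratic_module M -> adjoin M a a.
Proof.
move=> qM; exists 0, 1; split; [exact: qm0| |by rewrite add0r mul1r].
by have := sum_squares_sqr 1; rewrite expr1n.
Qed.

(** Zorn's lemma is applied to the sets Z such that M together with Z is a
    proper quadratic module, so that the union of the empty chain is admissible
    too. *)
Lemma maximal_qm M : quadratic_module M -> ~ M (-1) ->
  exists Q, [/\ quadratic_module Q, ~ Q (-1), M `<=` Q &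
    forall a, ~ Q a -> adjoin Q a (-1)].
Proof.
move=> qM M1.
pose P X := quadratic_module (M `|` X) /\ ~ (M `|` X) (-1).
have [F FP Ftot|Z [[qQ Q1] Zmax]] := @Zorn_bigcup A P.
  have common x y : (M `|` \bigcup_(X in F) X) x ->
      (M `|` \bigcup_(X in F) X) y ->
      (M x /\ M y) \/ exists X, [/\ F X, (M `|` X) x & (M `|` X) y].
    move=> [Mx|[X FX Xx]] [My|[Y FY Yy]].
    - by left.
    - by right; exists Y; split=> //; [left|right].
    - by right; exists X; split=> //; [right|left].
    - right; have [XY|YX] := Ftot _ _ FX FY.
      + by exists Y; split=> //; right => //; exact: XY.
      + by exists X; split=> //; right => //; exact: YX.
  have up X : F X -> M `|` X `<=` M `|` \bigcup_(X in F) X.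
    by move=> FX x [Mx|Xx]; [left|right; exists X].
  split; first split.
  - by left; exact: qm1.
  - move=> x y hx hy; have [[Mx My]|[X [FX Xx Xy]]] := common _ _ hx hy.
      by left; exact: qmD.
    by apply: (up X FX); apply: (qmD (proj1 (FP _ FX))).
  - move=> q x hx; have [[Mx _]|[X [FX Xx _]]] := common _ _ hx hx.
      by left; exact: qm_sqrM.
    by apply: (up X FX); apply: (qm_sqrM (proj1 (FP _ FX))).
  - move=> hx; have [[//]|[X [FX Xx _]]] := common _ _ hx hx.
    exact: (proj2 (FP _ FX)).
exists (M `|` Z); split=> [//|//|x Mx|]; first by left.
move=> a Qa; apply: contrapT => nadj.
have Eadj : M `|` adjoin (M `|` Z) a = adjoin (M `|` Z) a.
  by apply/setUidPr => x Mx; apply: adjoin_sub; left.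
apply: (Zmax (adjoin (M `|` Z) a)); last first.
  by rewrite /P Eadj; split=> //; exact: adjoin_qm.
split; first by move=> x Zx; apply: adjoin_sub; right.
by move=> /(_ a (adjoin_mem _ qQ)) Za; apply: Qa; right.
Qed.

(** If neither a nor -a were in the maximal Q, then -1 = s1 + t1 a and
    -1 = s2 - t2 a with s1, s2 in Q and sums of squares t1, t2.  Eliminating a
    puts t1 in the ideal formed by the elements x with both x and -x in Q; so
    t1 a and hence -1 are in Q. *)
Lemma maximal_qm_total Q : quadratic_module Q -> ~ Q (-1) ->
  (forall a, ~ Q a -> adjoin Q a (-1)) -> forall a, Q a \/ Q (- a).
Proof.
move=> qQ Q1 Qmax a; apply: contrapT => /not_orP[Qa QNa]; apply: Q1.
have [s1 [t1 [Qs1 St1 e1]]] := Qmax _ Qa.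
have [s2 [t2 [Qs2 St2 e2]]] := Qmax _ QNa.
have Qt1 : Q t1 by exact: qm_sum_squares.
have QNt1 : Q (- t1).
  have -> : - t1 = t2 + (t2 * s1 + t1 * s2).
    apply/eqP; rewrite -subr_eq0; apply/eqP.
    have -> : - t1 - (t2 + (t2 * s1 + t1 * s2)) =
       (-1 - (s1 + t1 * a)) * t2 + (-1 - (s2 + t2 * - a)) * t1 by ring.
    by rewrite -e1 -e2 subrr !mul0r addr0.
  apply: (qmD qQ); first exact: qm_sum_squares.
  by apply: (qmD qQ); exact: qmM_sum_squares.
(* Both t1 and - t1 are in Q, and a = ((a + 1) / 2)^2 - ((a - 1) / 2)^2. *)
have Qt1a : Q (t1 * a).
  have -> : t1 * a =
      (2^-1 *: (a + 1)) ^+ 2 * t1 + (2^-1 *: (a - 1)) ^+ 2 * - t1.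
    apply: (@scalerI _ _ 4); first by rewrite pnatr_eq0.
    have sq (x y : A) : 4 *: ((2^-1 *: x) ^+ 2 * y) = x ^+ 2 * y.
      rewrite exprZn -scalerAl scalerA.
      have -> : 4 * 2^-1 ^+ 2 = 1 :> R by field.
      by rewrite scale1r.
    by rewrite scalerDr !sq scaler_nat; ring.
  by apply: (qmD qQ); exact: qm_sqrM.
by rewrite e1; exact: qmD.
Qed.

Section CharacterOfMaximalModule.
Context (Q : set A) (qQ : quadratic_module Q) (Q1 : ~ Q (-1)).
Context (Qtot : forall a, Q a \/ Q (- a)) (Qarch : archimedean_set Q).

Let Q_scalar c : Q c%:A -> 0 <= c.
Proof.
move=> Qc; rewrite leNgt; apply/negP => c0; apply: Q1.
apply: (@qmZ_inv _ qQ (- c)); first by rewrite oppr_gt0.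
by rewrite scalerN scaleNr opprK.
Qed.

(** The relation saying that a and r differ by an infinitesimal of the ordering
    Q. *)
Let near_scalar a r : Prop :=
  forall e, 0 < e -> Q (a - (r - e)%:A) /\ Q ((r + e)%:A - a).

Let near_scalar_exists a : exists r, near_scalar a r.
Proof.
pose S := [set r | Q (a - r%:A)].
have S0 : S !=set0.
  have [N QN] := Qarch (- a); exists (- N%:R); rewrite /S /=.
  by rewrite scaleNr opprK scaler_nat addrC; rewrite opprK in QN.
have [N QN] := Qarch a.
have Sub : has_ubound S.
  exists N%:R => r Sr; rewrite -subr_ge0; apply: Q_scalar.
  by have := qmD qQ QN Sr; rewrite addrA subrK -scaler_nat -scalerBl.
exists (sup S) => e e0; split.
  have [r Sr lr] := sup_adherent e0 (conj S0 Sub).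
  have -> : a - (sup S - e)%:A = a - r%:A + (r - (sup S - e))%:A.
      by rewrite [in RHS]scalerBl; ring.
  by apply: (qmD qQ) => //; apply: (qm_scalar qQ); rewrite subr_ge0 ltW.
have [QS|] := Qtot (a - (sup S + e)%:A); last by rewrite opprB.
have := ub_le_sup Sub QS; rewrite gerDl => e1.
by have := lt_le_trans e0 e1; rewrite ltxx.
Qed.

Let near_scalar_le a b r r' : Q (b - a) -> near_scalar a r -> near_scalar b r'
  ->
  r <= r'.
Proof.
move=> Qab ar br; rewrite leNgt; apply/negP => rr'.
have e0 : 0 < (r - r') / 3 by rewrite divr_gt0 ?subr_gt0.
have := qmD qQ Qab (qmD qQ (proj1 (ar _ e0)) (proj2 (br _ e0))).
have -> : b - a + (a - (r - (r - r') / 3)%:A + ((r' + (r - r') / 3)%:A - b)) =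
   (r' + (r - r') / 3)%:A - (r - (r - r') / 3)%:A by ring.
rewrite -scalerBl => /Q_scalar; lra.
Qed.

Let near_scalar_unique a r r' : near_scalar a r -> near_scalar a r' -> r = r'.
Proof.
have Qaa : Q (a - a) by rewrite subrr; exact: qm0.
move=> h h'; apply/eqP.
by rewrite eq_le !(near_scalar_le _ h h', near_scalar_le _ h' h).
Qed.

Let near_scalar_scalar c : near_scalar c%:A c.
Proof.
by move=> e e0; rewrite -!scalerBl; split; apply: (qm_scalar qQ); lra.
Qed.

Let near_scalarD a b r r' : near_scalar a r -> near_scalar b r' ->
  near_scalar (a + b) (r + r').
Proof.
move=> ar br e e0; have e2 : 0 < e / 2 by rewrite divr_gt0.
have [a1 a2] := ar _ e2; have [b1 b2] := br _ e2; split.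
  have -> : a + b - (r + r' - e)%:A =
     (a - (r - e / 2)%:A) + (b - (r' - e / 2)%:A).
    by rewrite addrACA -opprD -scalerDl; congr (_ - _%:A); field.
  exact: qmD.
have -> : (r + r' + e)%:A - (a + b) =
     ((r + e / 2)%:A - a) + ((r' + e / 2)%:A - b).
  by rewrite addrACA -opprD -scalerDl; congr (_%:A - _); field.
exact: qmD.
Qed.

Let near_scalarZ_ge0 c a r : 0 <= c -> near_scalar a r ->
  near_scalar (c *: a) (c * r).
Proof.
rewrite le_eqVlt => /predU1P[<- _|c0 ar e e0].
  by rewrite scale0r mul0r -(scale0r 1); exact: near_scalar_scalar.
have [a1 a2] := ar (e / c) (divr_gt0 e0 c0).
have k : c * (e / c) = e by rewrite mulrC divfK ?gt_eqF.
split.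
  by have := qmZ qQ (ltW c0) a1; rewrite scalerBr scalerA mulrBr k.
by have := qmZ qQ (ltW c0) a2; rewrite scalerBr scalerA mulrDr k.
Qed.

Let near_scalarN a r : near_scalar a r -> near_scalar (- a) (- r).
Proof.
move=> ar e e0; have [a1 a2] := ar e e0; split.
  by rewrite -[- r - e]opprD scaleNr opprK addrC.
by rewrite opprK addrC -[- r + e]opprK opprD opprK scaleNr.
Qed.

Let near_scalar_sqr0 a : near_scalar a 0 -> near_scalar (a ^+ 2) 0.
Proof.
move=> a0 e e0; split.
  rewrite sub0r scaleNr opprK; apply: (qmD qQ).
    by apply: (qm_sum_squares qQ); exact: sum_squares_sqr.
  by apply: (qm_scalar qQ); exact: ltW.
have se0 : 0 < Num.sqrt e by rewrite sqrtr_gt0.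
have [a1 a2] := a0 _ se0; rewrite sub0r scaleNr opprK in a1.
rewrite add0r in a2; rewrite add0r -(sqr_sqrtr (ltW e0)).
by apply: (qm_bound_sqr qQ) => //; rewrite addrC.
Qed.

Let near_scalar_sqr a r : near_scalar a r -> near_scalar (a ^+ 2) (r ^+ 2).
Proof.
move=> ar; pose b := a - r%:A.
have b0 : near_scalar b 0.
  rewrite -(subrr r); apply: near_scalarD => //; apply: near_scalarN.
  exact: near_scalar_scalar.
have rb : near_scalar (r *: (b *+ 2)) 0.
  have pos c : 0 <= c -> near_scalar (c *: (b *+ 2)) 0.
    move=> c0; rewrite -(mulr0 c); apply: near_scalarZ_ge0 => //.
    by rewrite mulr2n -(addr0 0); exact: near_scalarD.
  case: (leP 0 r) => r0; first exact: pos.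
  rewrite -[r]opprK scaleNr -[0]oppr0; apply: near_scalarN; apply: pos.
  by rewrite oppr_ge0 ltW.
have -> : a ^+ 2 = (r ^+ 2)%:A + (r *: (b *+ 2) + b ^+ 2).
  have -> : (r ^+ 2)%:A = r%:A ^+ 2 :> A.
    by rewrite !expr2 -scalerAl mul1r scalerA.
  have -> : r *: (b *+ 2) = r%:A * (b *+ 2) by rewrite -scalerAl mul1r.
  by rewrite /b; ring.
have := near_scalarD (near_scalar_scalar (r ^+ 2))
  (near_scalarD rb (near_scalar_sqr0 b0)).
by rewrite !addr0.
Qed.

Lemma maximal_qm_character :
  exists2 alpha, character alpha & forall a, Q a -> 0 <= alpha a.
Proof.
pose alpha a := projT1 (cid (near_scalar_exists a)).
have alphaP a : near_scalar a (alpha a) := projT2 (cid (near_scalar_exists a)).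
have alphaE a r : near_scalar a r -> alpha a = r.
  by move=> ar; exact: near_scalar_unique (alphaP a) ar.
exists alpha; last first.
  move=> a Qa; apply: (@near_scalar_le 0 a) => //; first by rewrite subr0.
  by rewrite -(scale0r 1); exact: near_scalar_scalar.
split=> [c|a b|a b].
- exact/alphaE/near_scalar_scalar.
- exact/alphaE/near_scalarD.
- apply: alphaE.
  have -> : a * b = 2^-1 *: ((a + b) ^+ 2 - (a ^+ 2 + b ^+ 2)).
    have -> : (a + b) ^+ 2 - (a ^+ 2 + b ^+ 2) = 2%:R *: (a * b).
      by rewrite scaler_nat; ring.
    by rewrite scalerA mulVf ?pnatr_eq0// scale1r.
  have -> : alpha a * alpha b =
     2^-1 * ((alpha a + alpha b) ^+ 2 - (alpha a ^+ 2 + alpha b ^+ 2)) by field.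
  apply: near_scalarZ_ge0; first by rewrite invr_ge0.
  apply: near_scalarD; first exact/near_scalar_sqr/near_scalarD.
  by apply: near_scalarN; apply: near_scalarD; exact: near_scalar_sqr.
Qed.

End CharacterOfMaximalModule.

(** If -1 were not of the form s - t f with s in M and t a sum of squares, then
    -f would lie in a maximal proper module, whose character contradicts f > 0.
    So t f - 1 is in M.  It remains to divide by t.  Let k be so large that
    2 k - t and k - t^2 f are in M.  Then k f + j + 1 in M implies k f + j in M,
    because k^2 (k f + j) equals
      (k - t)^2 (k f + j + 1) + 2 k^2 (t f - 1) + (j + 1) t (2 k - t)
        + k (k - t^2 f),
    and one descends from some k f + N in M to k f. *)
Theorem archimedean_positivstellensatz M f : quadratic_module M ->
  archimedean_set M ->
  (forall alpha, character alpha -> (forall a, M a -> 0 <= alpha a) ->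
    0 < alpha f) ->
  M f.
Proof.
move=> qM archM fpos.
have [s [t [Ms St e]]] : adjoin M (- f) (-1).
  apply: contrapT => nadj.
  have [Q [qQ Q1 MQ Qmax]] := maximal_qm (adjoin_qm (- f) qM) nadj.
  have MQ' : M `<=` Q by move=> x Mx; apply: MQ; exact: adjoin_sub.
  have archQ : archimedean_set Q.
    by move=> a; have [N MN] := archM a; exists N; exact: MQ'.
  have [alpha chi alphaQ] := maximal_qm_character qQ Q1
    (maximal_qm_total qQ Q1 Qmax) archQ.
  have := fpos _ chi (fun a Ma => alphaQ _ (MQ' _ Ma)).
  have := alphaQ _ (MQ _ (adjoin_mem (- f) qM)).
  have : alpha (- f) = - alpha f.
    by rewrite -mulN1r -scaleN1r (charM chi) (char_scalar chi) mulN1r.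
  by move=> ->; rewrite oppr_ge0 leNgt => /negbTE ->.
have tf1 : M (t * f - 1).
  have -> : t * f - 1 = s by rewrite e; ring.
  exact: Ms.
have [k1 Mk1] := archM t; have [k2 Mk2] := archM (t ^+ 2 * f).
have up N N' a : (N <= N')%N -> M (N%:R - a) -> M (N'%:R - a).
  move=> /subnKC <- h; rewrite natrD addrAC; apply: (qmD qM) => //.
  exact: qm_nat.
pose k := (k1 + k2).+1.
have Mkt : M ((k + k)%:R - t).
  by apply: up Mk1; rewrite /k -addnS -addnA leq_addr.
have Mkf : M (k%:R - t ^+ 2 * f) by apply: up Mk2; rewrite /k -addSn leq_addl.
have step j : M (k%:R * f + j.+1%:R) -> M (k%:R * f + j%:R).
  move=> Mj; apply: (@qmZ_inv _ qM (k ^ 2)%:R); first by rewrite ltr0n.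
  have -> : (k ^ 2)%:R *: (k%:R * f + j%:R) =
     (k%:R - t) ^+ 2 * (k%:R * f + j.+1%:R) + (2 * k * k)%:R * (t * f - 1)
     + (j.+1)%:R * (t * ((k + k)%:R - t)) + k%:R * (k%:R - t ^+ 2 * f).
    rewrite scaler_nat -[_ *+ (k ^ 2)]mulr_natl natrX -natr1 !natrM natrD.
    by ring.
  have Mn N a : M a -> M (N%:R * a).
    by move=> Ma; rewrite -[N%:R]scaler_nat -scalerAl mul1r; apply: qmZ.
  apply: (qmD qM); last exact: Mn.
  apply: (qmD qM); last by apply: Mn; exact: qmM_sum_squares.
  apply: (qmD qM); last exact: Mn.
  exact: qm_sqrM.
have [N MN] := archM (- (k%:R * f)); rewrite opprK addrC in MN.
have Mkf0 : M (k%:R * f).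
  rewrite -[k%:R * f]addr0 -[0]/(0%:R).
  by elim: N MN => // N IH /step.
apply: (@qmZ_inv _ qM k%:R); first by rewrite ltr0n.
by rewrite scaler_nat -mulr_natl.
Qed.

End QuadraticModules.

(** * Putinar's theorem *)

Section Putinar.
Context {R : realType} {n m : nat}.
Implicit Types (g : 'I_m -> {mpoly R[n]}) (f p : {mpoly R[n]}).

Lemma character_meval (alpha : {mpoly R[n]} -> R) : character alpha ->
  forall p, alpha p = p.@[fun i => alpha 'X_i].
Proof.
move=> chi p.
have a0 : alpha 0 = 0 by rewrite -(scale0r 1) (char_scalar chi).
have a1 : alpha 1 = 1 by rewrite -(scale1r 1) (char_scalar chi).
rewrite mevalE [in LHS](mpolyE p) (big_morph alpha (charD chi) a0).
apply: eq_bigr => mu _; rewrite -[_ *: _]mul1r -scalerAr scalerAl.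
rewrite (charM chi) (char_scalar chi) mpolyXE_id.
rewrite (big_morph alpha (charM chi) a1); congr (_ * _).
apply: eq_bigr => i _; elim: (mu i) => [|e IH]; first by rewrite !expr0.
by rewrite !exprS (charM chi) IH.
Qed.

Definition quadratic_module_of g : set {mpoly R[n]} :=
  [set h | exists s0 s, [/\ sos s0, (forall j, sos (s j)) &
    h = s0 + \sum_(j < m) s j * g j]].

Lemma quadratic_module_of_qm g : quadratic_module (quadratic_module_of g).
Proof.
split.
- exists 1, (fun=> 0); split=> [|j|].
  + by exists [:: 1]; rewrite big_seq1 expr1n.
  + exact: sum_squares0.
  + by rewrite big1 ?addr0// => j _; rewrite mul0r.
- move=> x y [s0 [s [S0 S ->]]] [t0 [t [T0 T ->]]].
  exists (s0 + t0), (fun j => s j + t j); split=> [|j|].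
  + exact: sum_squaresD S0 T0.
  + exact: sum_squaresD (S j) (T j).
  + by rewrite addrACA -big_split; congr (_ + _); apply: eq_bigr => j _;
    rewrite mulrDl.
- move=> q x [s0 [s [S0 S ->]]].
  exists (q ^+ 2 * s0), (fun j => q ^+ 2 * s j); split=> [|j|].
  + exact: sum_squares_sqrM S0.
  + exact: sum_squares_sqrM (S j).
  + by rewrite mulrDr mulr_sumr; congr (_ + _); apply: eq_bigr => j _;
    rewrite mulrA.
Qed.

Lemma quadratic_module_of_gen g j : quadratic_module_of g (g j).
Proof.
exists 0, (fun i => (i == j)%:R); split=> [|i|].
- exact: sum_squares0.
- by case: (i == j); [exists [:: 1];
  rewrite big_seq1 expr1n|exact: sum_squares0].
- rewrite add0r (bigD1 j)//= eqxx mul1r big1 ?addr0// => i /negbTE ->.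
  by rewrite mul0r.
Qed.

(** The elements bounded modulo M form a subalgebra, so it is enough to bound
    the variables; c - X_i^2 is the given element plus the other squares. *)
Lemma archimedean_of_norm_bound (M : set {mpoly R[n]}) (c : R) :
  quadratic_module M -> M (c%:MP - \sum_(l < n) 'X_l ^+ 2) -> archimedean_set M.
Proof.
move=> qM Mc.
suff bnd p : qm_bounded (M := M) p by move=> p; have [N []] := bnd p; exists N.
have b1 : qm_bounded (M := M) 1 by exact: (qm_bounded_nat qM 1).
have bX i : qm_bounded (M := M) 'X_i.
  apply: (qm_bounded_of_sqr qM (N := Num.bound `|c|)).
  have -> : (Num.bound `|c|)%:R - 'X_i ^+ 2 = ((Num.bound `|c|)%:R - c)%:A +
     (c%:MP - \sum_(l < n) 'X_l ^+ 2) + \sum_(l < n | l != i) 'X_l ^+ 2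
       :> {mpoly R[n]}.
    rewrite [in RHS](bigD1 i)//= scalerBl scaler_nat alg_mpolyC; ring.
  apply: (qmD qM); first apply: (qmD qM) => //.
    apply: (qm_scalar qM); rewrite subr_ge0 (le_trans (ler_norm c))//.
    by rewrite ltW// archi_boundP// normr_ge0.
  by apply: (qm_sum qM) => l _; apply: (qm_sum_squares qM);
    exact: sum_squares_sqr.
rewrite (mpolyE p); apply: big_ind => [||mu _].
- exact: (qm_bounded_nat qM 0).
- exact: qm_boundedD.
- apply: (qm_boundedZ qM); rewrite mpolyXE_id; apply: big_ind => [//||i _].
    exact: qm_boundedM.
  by elim: (mu i) => [|e IH]; rewrite ?expr0// exprS; exact: qm_boundedM.
Qed.

Theorem putinar g f (c : R) :
  quadratic_module_of g (c%:MP - \sum_(l < n) 'X_l ^+ 2) ->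
  (forall x, semialg g x -> 0 < f.@[x ord0]) ->
  quadratic_module_of g f.
Proof.
move=> gc fpos; have qM := quadratic_module_of_qm g.
apply: (archimedean_positivstellensatz qM).
  exact: archimedean_of_norm_bound gc.
move=> alpha chi alpha_ge0; pose x : 'rV[R]_n := \row_i alpha 'X_i.
have E p : alpha p = p.@[x ord0].
  by rewrite (character_meval chi); apply: meval_eq => i; rewrite mxE.
rewrite E; apply: fpos => j; rewrite -E.
exact/alpha_ge0/quadratic_module_of_gen.
Qed.

End Putinar.

(** * Moment functionals and feasibility of the relaxations *)

Section Degree.
Context {R : realType} {n : nat}.
Implicit Types p q : {mpoly R[n]}.

Lemma mdegree_le_msize p d : (mdegree p <= d)%N = (msize p <= d.+1)%N.
Proof. by rewrite /mdegree -subn1 leq_subLR. Qed.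

Lemma mdegreeM_le p q : (mdegree (p * q) <= mdegree p + mdegree q)%N.
Proof.
have [->|p0] := eqVneq p 0; first by rewrite mul0r /mdegree msize0.
have [->|q0] := eqVneq q 0; first by rewrite mulr0 /mdegree msize0.
rewrite /mdegree msizeM//; move: p0 q0; rewrite -!msize_poly_eq0.
by case: (msize p) => [//|a] _; case: (msize q) => [//|b] _;
  rewrite addSn addnS.
Qed.

Lemma mdegree_sqr_le p d : (mdegree p <= d)%N -> (mdegree (p ^+ 2) <= 2 * d)%N.
Proof.
by move=> pd; rewrite expr2 (leq_trans (mdegreeM_le _ _))// mul2n -addnn
  leq_add.
Qed.

End Degree.

Section RieszFunctional.
Context {R : realType} {n : nat}.

Lemma riesz_is_scalar d (z : 'X_{1..n < d.+1} -> R) : scalar (riesz z).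
Proof.
move=> c p q; rewrite /riesz mulr_sumr -big_split; apply: eq_bigr => a _ /=.
by rewrite mcoeffD mcoeffZ mulrDl mulrA.
Qed.

HB.instance Definition _ d (z : 'X_{1..n < d.+1} -> R) :=
  GRing.isLinear.Build R {mpoly R[n]} R *%R (riesz z) (riesz_is_scalar z).

(** Every moment sequence used below arises by restricting a linear functional
    on the whole polynomial ring.  A sequence z of order j also gives one,
    namely riesz z, which is how z is truncated to a lower order. *)
Lemma riesz_of_scalar (L : {scalar {mpoly R[n]}}) d p : (mdegree p <= d)%N ->
  riesz (fun a : 'X_{1..n < d.+1} => L 'X_[a]) p = L p.
Proof.
rewrite mdegree_le_msize => pd; rewrite [in RHS](mpolywE pd) linear_sum.
by apply: eq_bigr => a _; rewrite linearZ.
Qed.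

Lemma exponent_sum (V : nmodType) r (F : 'X_{1..n} -> V) :
  \sum_(a < #|{: 'X_{1..n < r.+1}}|) F (exponent a) =
  \sum_(a : 'X_{1..n < r.+1}) F a.
Proof.
rewrite (reindex (@enum_val _ {: 'X_{1..n < r.+1}})) /=; last first.
  by apply: onW_bij; exact: enum_val_bij.
by apply: eq_bigl => a.
Qed.

Lemma localizingmx_form d (z : 'X_{1..n < d.+1} -> R) r q
    (u : 'cV[R]_#|{: 'X_{1..n < r.+1}}|) :
  (u^T *m localizingmx z r q *m u) ord0 ord0 =
  riesz z (q * (\sum_a u a ord0 *: 'X_[exponent a]) ^+ 2).
Proof.
rewrite expr2 mulr_sumr mulr_sumr linear_sum mxE; apply: eq_bigr => b _.
rewrite mxE mulr_suml mulr_suml mulr_sumr linear_sum; apply: eq_bigr => a _.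
rewrite !mxE -!(scalerAl, scalerAr) !linearZ /= mpolyXD.
by rewrite /GRing.scale /=; set c := riesz _ _; ring.
Qed.

(** A localizing matrix is the Gram matrix of the form h |-> L(q h^2) on the
    polynomials of degree at most r. *)
Lemma psd_localizingmx d (z : 'X_{1..n < d.+1} -> R) r q :
  psdmx (localizingmx z r q) <->
  forall h : {mpoly R[n]}, (mdegree h <= r)%N -> 0 <= riesz z (q * h ^+ 2).
Proof.
split=> [[_ psd] h hr|psd].
  have := psd (\col_a h@_(exponent a)); rewrite localizingmx_form.
  under eq_bigr => a _ do rewrite mxE.
  rewrite (exponent_sum r (fun a => h@_a *: 'X_[a])) -mpolywE//.
  by rewrite -mdegree_le_msize.
split=> [|u].
  by apply/matrixP => a b; rewrite !mxE addmC.
rewrite localizingmx_form; apply: psd; rewrite mdegree_le_msize.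
apply: (leq_trans (msize_sum _ _ _)); apply/bigmax_leqP => a _.
apply: (leq_trans (msizeZ_le _ _)); rewrite msizeX.
by rewrite /exponent; case: (enum_val a).
Qed.

Lemma momentmx_localizing d (z : 'X_{1..n < d.+1} -> R) r :
  momentmx z r = localizingmx z r 1.
Proof. by apply/matrixP => a b; rewrite !mxE mul1r. Qed.

End RieszFunctional.

Section Feasibility.
Context {R : realType} {n m : nat}.
Context (f : {mpoly R[n]}) (g : 'I_m -> {mpoly R[n]}) (k : 'I_n).
Context (xl xu : R) (xlu : xl < xu).

Lemma mdegree_localized i (q h : {mpoly R[n]}) : (half_degree q <= i)%N ->
  (mdegree h <= i - half_degree q)%N -> (mdegree (q * h ^+ 2) <= 2 * i)%N.
Proof.
move=> qi /mdegree_sqr_le hi; rewrite (leq_trans (mdegreeM_le _ _))//.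
have : (mdegree q <= 2 * half_degree q)%N by rewrite /half_degree; lia.
lia.
Qed.

Lemma mdegree_Xn (l : nat) : mdegree ('X_k ^+ l : {mpoly R[n]}) = l.
Proof. by rewrite /mdegree mpolyXn msizeX /= mdegMn mdeg1 mul1n. Qed.

(** All polynomials h^2, g_j h^2 and x_k^l that occur in the constraints have
    degree at most 2 i, where the truncated sequence represents L. *)
Lemma scalar_primal_feasible (L : {scalar {mpoly R[n]}}) (i : nat) :
  (forall j, half_degree (g j) <= i)%N ->
  (forall h, (mdegree h <= i)%N -> 0 <= L (h ^+ 2)) ->
  (forall j h, (mdegree h <= i - half_degree (g j))%N ->
    0 <= L (g j * h ^+ 2)) ->
  (forall l, (l <= 2 * i)%N -> L ('X_k ^+ l) = uniform_moment xlu l) ->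
  primal_feasible g k xlu (i := i) (fun a => L 'X_[a]).
Proof.
move=> gi L1 Lg LX; split.
- rewrite momentmx_localizing psd_localizingmx => h hi.
  by rewrite mul1r riesz_of_scalar ?mdegree_sqr_le// L1.
- move=> j; rewrite psd_localizingmx => h hi.
  by rewrite riesz_of_scalar ?mdegree_localized// Lg.
- by move=> l li; rewrite riesz_of_scalar ?mdegree_Xn// LX.
Qed.

Lemma primal_value_le_scalar (L : {scalar {mpoly R[n]}}) (i : nat) :
  (mdegree f <= 2 * i)%N ->
  primal_feasible g k xlu (i := i) (fun a => L 'X_[a]) ->
  (primal_value f g k xlu i <= (L f)%:E)%E.
Proof.
move=> fi feas; apply: ereal_inf_lbound; eexists; first exact: feas.
by rewrite riesz_of_scalar.
Qed.

(** Truncating a feasible sequence of order j leaves a feasible sequence of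
    order i with the same value at f. *)
Lemma primal_value_nondecreasing i j : (i <= j)%N ->
  (forall l, half_degree (g l) <= i)%N -> (mdegree f <= 2 * i)%N ->
  (primal_value f g k xlu i <= primal_value f g k xlu j)%E.
Proof.
move=> ij gi fi; apply: le_ereal_inf_tmp => _ [z [z1 zg zX] <-].
move: z1 zX; rewrite momentmx_localizing => /psd_localizingmx z1 zX.
apply: (@primal_value_le_scalar (riesz z)) => //.
apply: scalar_primal_feasible => // [h hi|j' h hi|l li].
- by rewrite -[h ^+ 2]mul1r; apply: z1; exact: leq_trans ij.
- have /psd_localizingmx := zg j'; apply.
  by rewrite (leq_trans hi)// leq_sub2r.
- by apply: zX; rewrite (leq_trans li)// leq_mul2l ij orbT.
Qed.

Lemma dual_feasible_nondecreasing i j p s0 s : (i <= j)%N ->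
  dual_feasible f g k i p s0 s -> dual_feasible f g k j p s0 s.
Proof.
move=> ij [pi [S0 s0i] S e].
have ij2 : (2 * i <= 2 * j)%N by rewrite leq_mul2l ij orbT.
split=> //; first by rewrite (leq_trans pi).
  by split=> //; exact: leq_trans ij2.
by move=> j'; have [Sj sj] := S j'; split=> //; exact: leq_trans ij2.
Qed.

Lemma dual_value_nondecreasing i j : (i <= j)%N ->
  (dual_value f g k xlu i <= dual_value f g k xlu j)%E.
Proof.
move=> ij; apply: ereal_sup_le => _ [p [s0 [s feas]] <-]; exists p => //.
by exists s0, s; exact: dual_feasible_nondecreasing feas.
Qed.

(** Once every square q^2 in the certificate has deg q within the range of its
    localizing matrix, a feasible functional is nonnegative on each term, so one
    certificate serves both programs.  The bound on the order is the sum of all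
    degrees involved. *)
Lemma certificate_eventually (p : {poly R}) :
  quadratic_module_of g (f - horner_alg 'X_k p) ->
  exists N : nat, forall i, (N <= i)%N ->
    (exists s0 s, dual_feasible f g k i p s0 s) /\
    forall z, primal_feasible g k xlu (i := i) z ->
      riesz z (horner_alg 'X_k p) <= riesz z f.
Proof.
move=> [s0 [s [[t0 S0] S e]]]; have /choice[t S'] := S.
pose B (r : seq {mpoly R[n]}) := (\max_(q <- r) mdegree q)%N.
have Bq r q : q \in r -> (mdegree q <= B r)%N.
  by move=> qr; exact: leq_bigmax_seq.
pose N := (size p + mdegree s0 + (B t0 + \sum_j (mdegree (s j * g j) +
  (half_degree (g j) + B (t j)))))%N.
exists N => i Ni.
have ip : (size p <= i)%N by move: Ni; rewrite /N; lia.
have is0 : (mdegree s0 <= i)%N by move: Ni; rewrite /N; lia.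
have it0 : (B t0 <= i)%N by move: Ni; rewrite /N; lia.
have ij j : (mdegree (s j * g j) + (half_degree (g j) + B (t j)) <= i)%N.
  by move: Ni; rewrite /N (bigD1 j)//=; lia.
split.
  exists s0, s; split=> [||j|//].
  - lia.
  - by split; [exists t0|lia].
  - by split=> //; have := ij j; lia.
move=> z [z1 zg _]; rewrite -subr_ge0 -linearB e linearD linear_sum /=.
apply: addr_ge0.
  rewrite S0 linear_sum big_seq; apply: sumr_ge0 => q qt0.
  move: z1; rewrite momentmx_localizing => /psd_localizingmx z1.
  by rewrite -[q ^+ 2]mul1r; apply: z1; exact: leq_trans (Bq _ _ qt0) it0.
apply: sumr_ge0 => j _; rewrite S' mulr_suml linear_sum big_seq.
apply: sumr_ge0 => q qtj; rewrite mulrC.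
have /psd_localizingmx := zg j; apply.
by have := Bq _ _ qtj; have := ij j; lia.
Qed.

End Feasibility.

(** * Polynomial approximation of Lipschitz functions *)

Section LipschitzApproximation.
Context {R : realType}.
Implicit Types (F : nat -> R) (h : R -> R) (p : {poly R}).

Definition lipschitz_with (c : R) h : Prop :=
  forall u v, `|h u - h v| <= c * `|u - v|.

(** Pascal's rule, read as a definition of the Bernstein polynomial
    sum_k F(k) C(N,k) X^k (1 - X)^(N-k). *)
Fixpoint bernstein (N : nat) F : {poly R} :=
  if N is N'.+1 then 'X * bernstein N' (F \o S) + (1 - 'X) * bernstein N' F
  else (F 0%N)%:P.

Lemma bernstein_le N F G (x : R) : 0 <= x <= 1 -> (forall i, F i <= G i) ->
  (bernstein N F).[x] <= (bernstein N G).[x].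
Proof.
move=> /andP[x0 x1]; elim: N F G => [|N IH] F G FG /=;
  first by rewrite !hornerE.
rewrite !hornerE lerD// ler_wpM2l ?subr_ge0// IH// => i; exact: FG.
Qed.

(** For F(i) = i and F(i) = (i - N x)^2 these are the mean N x and the variance
    N x (1 - x) of the binomial law. *)
Lemma bernstein_quadratic N F (x a b c : R) :
  (forall i : nat, F i = a + b * i%:R + c * i%:R ^+ 2) ->
  (bernstein N F).[x] =
    a + b * (N%:R * x) + c * (N%:R * x * (1 - x) + N%:R ^+ 2 * x ^+ 2).
Proof.
elim: N F a b c => [|N IH] F a b c FE /=.
  by rewrite hornerC FE; ring.
have E1 : (1 - 'X).[x] = 1 - x by rewrite !hornerE.
rewrite hornerD !hornerM E1 hornerX (IH F a b c FE) (IH (F \o S) (a + b + c) (b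
  + 2 * c) c).
  by rewrite -natr1; ring.
by move=> i /=; rewrite FE -natr1; ring.
Qed.

(** With d = |i/N - x|, the inequality 2 e c d <= e^2 + c^2 d^2 bounds the error
    at i by a quadratic polynomial in i, so that the Bernstein average of the
    error is controlled by the variance of the binomial law.  For
    N >= c^2 / e^2 the variance contributes at most e / 2. *)
Lemma lipschitz_bernstein (c : R) h (e : R) : lipschitz_with c h -> 0 < e ->
  exists p, forall x, 0 <= x <= 1 -> `|p.[x] - h x| <= e.
Proof.
move=> hc e0; pose N := (Num.bound (c ^+ 2 / e ^+ 2)).+1.
have Nge : c ^+ 2 / e ^+ 2 <= N%:R.
  rewrite -natr1 (le_trans (ltW (archi_boundP _)))//.
    by rewrite divr_ge0// sqr_ge0.
  by rewrite lerDl.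
have N0 : 0 < N%:R :> R by rewrite ltr0n.
exists (bernstein N (fun i => h (i%:R / N%:R))) => x x01.
pose B := c ^+ 2 / (2 * e * N%:R ^+ 2).
have bound i : `|h (i%:R / N%:R) - h x| <= e / 2 + B * (i%:R - N%:R * x) ^+ 2.
  apply: (le_trans (hc _ _)).
  set d := `|_ - x|.
  have -> : B * (i%:R - N%:R * x) ^+ 2 = (c * d) ^+ 2 / (2 * e).
    rewrite exprMn /d real_normK ?num_real// /B; field.
    by rewrite !gt_eqF.
  rewrite -subr_ge0.
  have -> : e / 2 + (c * d) ^+ 2 / (2 * e) - c * d = (e - c * d) ^+ 2 / (2 * e).
    by field; rewrite gt_eqF.
  by rewrite divr_ge0 ?sqr_ge0// mulr_ge0// ltW.
have val (s a : R) : (bernstein N (fun i => a + s * (e / 2 +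
    B * (i%:R - N%:R * x) ^+ 2))).[x] = a + s * (e / 2 + B * (N%:R * x * (1 -
      x))).
  rewrite (@bernstein_quadratic _ _ _
    (a + s * (e / 2 + B * (N%:R * x) ^+ 2)) (- 2 * s * B * (N%:R * x)) (s * B)).
    by ring.
  by move=> i; ring.
have small : e / 2 + B * (N%:R * x * (1 - x)) <= e.
  have -> : B * (N%:R * x * (1 - x)) =
      (c ^+ 2 / e ^+ 2) / N%:R * (x * (1 - x)) * (e / 2).
    by rewrite /B; field; rewrite !gt_eqF.
  have x4 : 0 <= x * (1 - x) <= 1 by case/andP: x01 => ? ?; apply/andP; split;
    nra.
  have q1 : (c ^+ 2 / e ^+ 2) / N%:R <= 1 by rewrite ler_pdivrMr// mul1r.
  have q0 : 0 <= (c ^+ 2 / e ^+ 2) / N%:R.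
    by rewrite divr_ge0// ?divr_ge0 ?sqr_ge0// ltW.
  have : (c ^+ 2 / e ^+ 2) / N%:R * (x * (1 - x)) <= 1.
    by case/andP: x4 => ? ?; rewrite mulr_ile1.
  move=> /(ler_wpM2r (ltW e0)); lra.
rewrite ler_norml; apply/andP; split.
  rewrite lerBrDr; apply: le_trans (_ : _ <= h x + -1 * (e / 2 +
     B * (N%:R * x * (1 - x)))) _; first lra.
  rewrite -val; apply: bernstein_le => // i.
  by have := bound i; rewrite ler_norml => /andP[]; lra.
rewrite lerBlDr; apply: le_trans (_ : h x + 1 * (e / 2 +
     B * (N%:R * x * (1 - x))) <= _); last lra.
rewrite -val; apply: bernstein_le => // i.
by have := bound i; rewrite ler_norml => /andP[]; lra.
Qed.

Lemma lipschitz_poly_approx (a b : R) : a < b ->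
  forall (c : R) h (e : R), lipschitz_with c h -> 0 < e ->
  exists p, forall y, a <= y <= b -> `|p.[y] - h y| <= e.
Proof.
move=> ab c h e hc e0; have ba : 0 < b - a by rewrite subr_gt0.
have [|p pP] := @lipschitz_bernstein (c * (b - a)) (fun t => h (a + (b - a) *
  t))
    _ _ e0.
  move=> u v; apply: (le_trans (hc _ _)).
  have -> : a + (b - a) * u - (a + (b - a) * v) = (b - a) * (u - v) by ring.
  by rewrite normrM (gtr0_norm ba) mulrA.
exists (p \Po ((b - a)^-1 *: ('X - a%:P))) => y /andP[ay yb].
have E : ((b - a)^-1 *: ('X - a%:P)).[y] = (b - a)^-1 * (y - a).
  by rewrite !hornerE.
rewrite horner_comp E; have := pP ((b - a)^-1 * (y - a)).
have -> : a + (b - a) * ((b - a)^-1 * (y - a)) = y.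
  by field; rewrite gt_eqF.
apply.
rewrite mulr_ge0 ?invr_ge0 ?subr_ge0 ?(ltW ab)//=.
by rewrite mulrC ler_pdivrMr// mul1r lerD2r.
Qed.

End LipschitzApproximation.

(** * Lipschitz minorants of a fiberwise minimum *)

Lemma compact_bound {R : realType} {T : topologicalType} (K : set T)
    (h : T -> R) : compact K -> continuous h ->
  exists B, forall x, K x -> `|h x| <= B.
Proof.
move=> cK hc; have [K0|/set0P K0] := eqVneq K set0.
  by exists 0 => x; rewrite K0.
have ch : {within K, continuous (fun x => `|h x|)}.
  apply: continuous_subspaceT => x; apply: continuous_comp; first exact: hc.
  exact: norm_continuous.
have [c _ cP] := compact_EVT_max K0 cK ch.
by exists `|h c| => x Kx; apply: cP; rewrite inE.
Qed.

Section FiberwiseMinimum.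
Context {R : realType} {T : topologicalType} (K : set T) (K_compact : compact
  K).
Context (f pi : T -> R) (f_cont : continuous f) (pi_cont : continuous pi).
Context (Y : set R) (J : R -> R).
Hypothesis fiberwise_min_attained : forall y, Y y ->
  exists x, [/\ K x, pi x = y & f x = J y].
Hypothesis fiberwise_min_le : forall x, K x -> J (pi x) <= f x.
Context (y0 : R) (Yy0 : Y y0).

Let K_nonempty : K !=set0.
Proof. by have [x [Kx _ _]] := fiberwise_min_attained Yy0; exists x. Qed.

(** The infimal convolution of the fiberwise minimum of f with N |.|, computed
    on K. *)
Definition lipschitz_minorant (N y : R) : R :=
  inf [set f x + N * `|y - pi x| | x in K].

Lemma minorant_has_inf N y : 0 <= N ->
  has_inf [set f x + N * `|y - pi x| | x in K].
Proof.
move=> N0; split; first by have [x Kx] := K_nonempty; eexists; exists x.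
have [B fB] := compact_bound K_compact f_cont.
exists (- B) => _ [x Kx <-].
have := fB x Kx; rewrite ler_norml => /andP[fx _].
by rewrite (le_trans fx)// lerDl mulr_ge0.
Qed.

Lemma minorant_le N y x : 0 <= N -> K x ->
  lipschitz_minorant N y <= f x + N * `|y - pi x|.
Proof.
by move=> N0 Kx; apply: ge_inf; [case: (minorant_has_inf y N0)|exists x].
Qed.

Lemma minorant_ge N y (c : R) :
  (forall x, K x -> c <= f x + N * `|y - pi x|) -> c <= lipschitz_minorant N y.
Proof.
move=> cP; apply: lb_le_inf; last by move=> _ [x Kx <-]; exact: cP.
by have [x Kx] := K_nonempty; eexists; exists x.
Qed.

Lemma minorant_lipschitz N : 0 <= N -> lipschitz_with N (lipschitz_minorant N).
Proof.
move=> N0.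
have half u v : lipschitz_minorant N u - N * `|u - v| <= lipschitz_minorant N v.
  apply: minorant_ge => x Kx;
    rewrite lerBlDr (le_trans (minorant_le u N0 Kx))//.
  rewrite -addrA lerD2l -mulrDr ler_wpM2l//.
  by rewrite [leRHS]addrC ler_distD.
move=> u v; have := half u v; have := half v u.
by rewrite (distrC v u) ler_norml => ? ?; apply/andP; split; lra.
Qed.

Lemma minorant_le_fiberwise_min N y : 0 <= N -> Y y -> lipschitz_minorant N y
  <= J y.
Proof.
move=> N0 /fiberwise_min_attained[x [Kx <- <-]].
by rewrite (le_trans (minorant_le (pi x) N0 Kx))// subrr normr0 mulr0 addr0.
Qed.

(** The points of K where f is at most J y - e form a compact set missing the
    fiber of y, hence staying at a positive distance d from it; as soon as N d
    exceeds the oscillation of f, the penalty makes up for e. *)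
Lemma minorant_near y e : Y y -> 0 < e ->
  exists N0 : R, forall N, N0 <= N -> 0 <= N -> J y - e <= lipschitz_minorant N
    y.
Proof.
move=> Yy e0; have [B fB] := compact_bound K_compact f_cont.
pose C := K `&` f @^-1` [set t | t <= J y - e].
have clC : closed (f @^-1` [set t | t <= J y - e]).
  by apply: preimage_closed => //; exact: closed_le.
have cC : compact C by exact: compact_closedI.
have piC : {within C, continuous (fun x => `|y - pi x|)}.
  apply: continuous_subspaceT => x.
  apply: (@continuous_comp _ _ _ (fun x => y - pi x) (fun t : R => `|t|)).
    by apply: continuousB; [exact: cst_continuous|exact: pi_cont].
  exact: norm_continuous.
have [C0|/set0P C0] := eqVneq C set0.
  exists 0 => N _ N0; apply: minorant_ge => x Kx.
  have [fx|/ltW fx] := leP (f x) (J y - e).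
    suff : C x by rewrite C0.
    by split.
  by rewrite (le_trans fx)// lerDl mulr_ge0.
have [c /set_mem[Kc fc] cP] := compact_EVT_min C0 cC piC.
have d0 : 0 < `|y - pi c|.
  rewrite normr_gt0 subr_eq0; apply/eqP => yc.
  have := fiberwise_min_le Kc; rewrite -yc; move: fc => /= fc.
  move=> /le_trans/(_ fc); lra.
exists ((J y + B) / `|y - pi c|) => N NN0 N0; apply: minorant_ge => x Kx.
have [fx|/ltW fx] := leP (f x) (J y - e); last first.
  by rewrite (le_trans fx)// lerDl mulr_ge0.
have := cP x (mem_set (conj Kx fx)) => dx.
move: NN0; rewrite ler_pdivrMr// => NN0.
have := ler_wpM2l N0 dx; have := fB x Kx; rewrite ler_norml => /andP[].
lra.
Qed.

Lemma minorant_cvg y : Y y ->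
  (fun N : nat => lipschitz_minorant N%:R y) @ \oo --> J y.
Proof.
move=> Yy; apply/cvgrPdist_le => e e0.
have [N0 N0P] := minorant_near Yy e0.
near=> N.
have h1 := minorant_le_fiberwise_min (ler0n R N) Yy.
have h2 : J y - e <= lipschitz_minorant N%:R y.
  apply: N0P => //; near: N; exact: nbhs_infty_ger.
by rewrite ger0_norm ?subr_ge0//; lra.
Unshelve. all: by end_near. Qed.

Lemma fiberwise_min_bounded : exists B, forall y, Y y -> `|J y| <= B.
Proof.
have [B fB] := compact_bound K_compact f_cont; exists B => y.
by move=> /fiberwise_min_attained[x [Kx _ <-]]; exact: fB.
Qed.

Lemma minorant_bounded : exists B, forall N y, 0 <= N -> Y y ->
  `|lipschitz_minorant N y| <= B.
Proof.
have [B fB] := compact_bound K_compact f_cont; exists B => N y N0 Yy.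
have [x [Kx _ fx]] := fiberwise_min_attained Yy.
have := fB x Kx; rewrite fx !ler_norml => /andP[JB1 JB2].
rewrite (le_trans (minorant_le_fiberwise_min N0 Yy) JB2) andbT.
apply: minorant_ge => x' Kx'.
have := fB x' Kx'; rewrite ler_norml => /andP[fx' _].
by rewrite (le_trans fx')// lerDl mulr_ge0.
Qed.

End FiberwiseMinimum.

(** * Polynomials below a fiberwise minimum *)

Section IntegralsOnSegment.
Context {R : realType}.
Context (mu : {finite_measure set (measurableTypeR R) -> \bar R}).
Context (a b : R) (ab : a < b).
Let Y : set R := `[a, b]%classic.

Lemma measurable_segment : measurable (Y : set (measurableTypeR R)).
Proof. exact: measurable_itv. Qed.
Let mY := measurable_segment.

Lemma bounded_measurable_integrable (D : set (measurableTypeR R))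
    (h : measurableTypeR R -> R) (B : R) :
  measurable D -> measurable_fun D h -> (forall y, D y -> `|h y| <= B) ->
  mu.-integrable D (EFin \o h).
Proof.
move=> mD mh hB; apply: measurable_bounded_integrable => //.
  by rewrite ltey_eq fin_num_measure.
exists B; split; first exact: num_real.
by move=> M BM y Dy /=; rewrite (le_trans (hB _ Dy))// ltW.
Qed.

Lemma cst_integrable (D : set (measurableTypeR R)) (c : R) : measurable D ->
  mu.-integrable D (EFin \o cst c).
Proof.
by move=> mD; apply: (bounded_measurable_integrable mD (B := `|c|)).
Qed.

Lemma continuous_segment_integrable (h : R -> R) : continuous h ->
  mu.-integrable Y (EFin \o h).
Proof.
move=> hc.
have [B hB] := compact_bound (@segment_compact R a b) hc.
apply: (bounded_measurable_integrable mY) hB.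
apply: (@measurable_funS _ _ _ _ setT) => //.
exact: continuous_measurable_fun.
Qed.

Lemma poly_integrable (p : {poly R}) : mu.-integrable Y (EFin \o (fun x =>
  p.[x])).
Proof. by apply: continuous_segment_integrable; exact: continuous_horner. Qed.

Lemma lipschitz_with_continuous (c : R) (h : R -> R) : lipschitz_with c h ->
  continuous h.
Proof.
move=> hc x; apply/cvgrPdist_le => e e0; near=> y.
apply: (le_trans (hc _ _)).
have k0 : 0 < `|c| + 1 by rewrite ltr_wpDl.
apply: (@le_trans _ _ ((`|c| + 1) * `|x - y|)).
  by rewrite ler_wpM2r// (le_trans (ler_norm _))// lerDl.
rewrite mulrC -ler_pdivlMr//; near: y.
by apply: cvgr_dist_le; [exact: cvg_id|rewrite divr_gt0].
Unshelve. all: by end_near. Qed.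

End IntegralsOnSegment.

Section PolynomialsBelowFiberwiseMinimum.
Context {R : realType}.
Context (mu : {finite_measure set (measurableTypeR R) -> \bar R}).
Context (a b : R) (ab : a < b).
Let Y : set R := `[a, b]%classic.
Context {T : topologicalType} (K : set T) (K_compact : compact K).
Context (f pi : T -> R) (f_cont : continuous f) (pi_cont : continuous pi).
Context (J : R -> R).
Hypothesis fiberwise_min_attained : forall y, Y y ->
  exists x, [/\ K x, pi x = y & f x = J y].
Hypothesis fiberwise_min_le : forall x, K x -> J (pi x) <= f x.

Let Ya : Y a. Proof. by rewrite /Y /= in_itv /= lexx ltW. Qed.
Let minorant := lipschitz_minorant K f pi.
Let minorant_lip N : 0 <= N -> lipschitz_with N (minorant N) :=
  minorant_lipschitz K_compact f_cont fiberwise_min_attained Ya (N := N).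

Let minorant_measurable (N : nat) :
  measurable_fun (Y : set (measurableTypeR R)) (minorant N%:R).
Proof.
apply: (@measurable_funS _ _ _ _ setT) => //.
by apply: continuous_measurable_fun;
  exact: lipschitz_with_continuous (minorant_lip _).
Qed.

Let minorant_to (y : R) : Y y -> (fun N : nat => minorant N%:R y) @ \oo --> J y.
Proof.
exact: (minorant_cvg K_compact f_cont pi_cont fiberwise_min_attained
  fiberwise_min_le Ya).
Qed.

(** J is a pointwise limit of continuous functions. *)
Lemma fiberwise_min_measurable : measurable_fun (Y : set (measurableTypeR R)) J.
Proof. exact: measurable_fun_cvg minorant_measurable minorant_to. Qed.

Lemma fiberwise_min_integrable : mu.-integrable Y (EFin \o J).
Proof.
have [B JB] := fiberwise_min_bounded K_compact f_cont fiberwise_min_attained.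
apply: (bounded_measurable_integrable mu (measurable_segment a b)) JB.
exact: fiberwise_min_measurable.
Qed.

(** A minorant J_N whose integral is within e / 2 of that of J is approximated
    by a polynomial within some d, and the approximation is lowered by 2 d to
    stay strictly below J_N; this costs at most 3 d times the mass of Y. *)
Lemma poly_below_fiberwise_min (e : R) : 0 < e -> exists p : {poly R},
  (forall y, Y y -> p.[y] < J y) /\
  \int[mu]_(y in Y) J y - e <= \int[mu]_(y in Y) p.[y].
Proof.
move=> e0; have mY := measurable_segment a b.
have [B mB] := minorant_bounded K_compact f_cont fiberwise_min_attained Ya.
have Bint := cst_integrable mu B mY.
have intN (N : nat) : mu.-integrable Y (EFin \o minorant N%:R).
  apply: (bounded_measurable_integrable mu mY) (fun y => mB N%:R y (ler0n _ N)).
  exact: minorant_measurable.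
have [] := @dominated_convergence _ _ _ mu Y mY
    (fun (N : nat) y => (minorant N%:R y)%:E) (EFin \o J) (EFin \o cst B).
- by move=> N; apply/measurable_EFinP; exact: minorant_measurable.
- by apply/measurable_EFinP; exact: fiberwise_min_measurable.
- by apply: aeW => y Yy; apply: cvg_EFin; [exact: nearW|exact: minorant_to].
- exact: Bint.
- by apply: aeW => y N Yy; rewrite /= lee_fin; exact: mB.
move=> _ _ cvgI.
have cvgR : (fun N : nat => \int[mu]_(y in Y) minorant N%:R y) @ \oo -->
    \int[mu]_(y in Y) J y.
  apply: fine_cvg; rewrite fineK//.
  exact: (integrable_fin_num mY fiberwise_min_integrable).
pose M := fine (mu Y); have M0 : 0 <= M by apply: fine_ge0; exact: measure_ge0.
pose d := e / (6 * (M + 1)).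
have M1 : 0 < M + 1 by rewrite ltr_wpDl.
have d0 : 0 < d by rewrite divr_gt0// mulr_gt0.
have [N NP] : exists N : nat,
    \int[mu]_(y in Y) J y - e / 2 <= \int[mu]_(y in Y) minorant N%:R y.
  have /cvgrPdist_le/(_ (e / 2)) := cvgR.
  rewrite divr_gt0// => /(_ isT)[N _ /(_ N (leqnn N))] /=.
  by rewrite ler_norml => /andP[_ h]; exists N; lra.
have [p pP] := lipschitz_poly_approx ab (minorant_lip (ler0n R N)) d0.
exists (p - (2 * d)%:P).
have qE y : (p - (2 * d)%:P).[y] = p.[y] - 2 * d by rewrite !hornerE.
have pY y : Y y -> `|p.[y] - minorant N%:R y| <= d.
  by move=> Yy; apply: pP; move: Yy; rewrite /Y /= in_itv.
split=> [y Yy|].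
  have JN := minorant_le_fiberwise_min K_compact f_cont fiberwise_min_attained
    Ya (ler0n R N) Yy.
  rewrite -/minorant in JN.
  by have := pY y Yy; rewrite ler_norml qE => /andP[_]; lra.
have le1 : \int[mu]_(y in Y) (minorant N%:R y - 3 * d) <=
    \int[mu]_(y in Y) (p - (2 * d)%:P).[y].
  apply: le_Rintegral => //.
  - exact: (integrableB mY (intN N) (cst_integrable mu (3 * d) mY)).
  - exact: poly_integrable.
  - move=> y Yy; rewrite qE; have := pY y Yy; rewrite ler_norml => /andP[]; lra.
rewrite (le_trans _ le1)// RintegralB//;
  last exact: (cst_integrable mu (3 * d) mY).
rewrite Rintegral_cst// -/M.
have : 3 * d * M <= e / 2.
  have -> : 3 * d * M = e / 2 * (M / (M + 1)) by rewrite /d; field;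
    rewrite gt_eqF.
  rewrite ger_pMr ?divr_gt0// ler_pdivrMr//; lra.
lra.
Qed.

End PolynomialsBelowFiberwiseMinimum.

(** * Discretising a measure below the average of a function *)

Section Quadrature.
Context {R : realType}.
Context (mu : {finite_measure set (measurableTypeR R) -> \bar R}).
Context (a b : R) (ab : a < b).
Let Y : set R := `[a, b]%classic.
Let mY : measurable (Y : set (measurableTypeR R)) := measurable_segment a b.

(** Otherwise J would exceed its average over C by e at every point of C, and
    integrating would contradict mu C > 0.  If C is null, any point of it will
    do. *)
Lemma point_below_average (J : R -> R) (C : set R) (e : R) :
  measurable (C : set (measurableTypeR R)) -> C `<=` Y -> 0 < e ->
  mu.-integrable C (EFin \o J) ->
  exists y, [/\ Y y, C !=set0 -> C y &
    fine (mu C) * J y <= \int[mu]_(x in C) J x + e * fine (mu C)].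
Proof.
move=> mC CY e0 Ji.
have Ya : Y a by rewrite /Y /= in_itv /= lexx ltW.
have w0 : 0 <= fine (mu C) by apply: fine_ge0; exact: measure_ge0.
have [->|/set0P[c Cc]] := eqVneq C set0.
  exists a; split=> //; first by move=> [].
  by rewrite measure0 /= mul0r mulr0 Rintegral_set0 addr0.
have [wE|wN0] := eqVneq (fine (mu C)) 0.
  exists c; split=> //; first exact: CY.
  rewrite wE mul0r mulr0 addr0 /Rintegral null_set_integral//.
    exact: measurable_int Ji.
  by have := fineK (fin_num_measure mu C mC); rewrite wE => /esym.
have w_gt0 : 0 < fine (mu C) by rewrite lt_def wN0.
pose I := \int[mu]_(x in C) J x.
apply: contrapT => nex.
have big y : C y -> I / fine (mu C) + e <= J y.
  move=> Cy; rewrite leNgt; apply/negP => lt; apply: nex.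
  exists y; split=> //; first exact: CY.
  have -> : \int[mu]_(x in C) J x + e * fine (mu C) =
      fine (mu C) * (I / fine (mu C) + e) by rewrite -/I; field.
  by rewrite ler_wpM2l// ltW.
have : \int[mu]_(x in C) (I / fine (mu C) + e) <= I.
  apply: le_Rintegral => //.
  exact: cst_integrable.
rewrite Rintegral_cst// mulrDl divfK// gerDl leNgt mulr_gt0//.
Qed.

Section Cells.
Variable (N : nat).
Let mesh : R := (b - a) / N.+1%:R.
Let mesh_gt0 : 0 < mesh. Proof. by rewrite divr_gt0 ?subr_gt0. Qed.
Let cell (t : nat) : set R := Y `&` `[a + t%:R * mesh, a + t.+1%:R *
  mesh[%classic.
(* The cells are half-open, and the one with t = N + 1 contains b. *)
Let s := iota 0 N.+2.

Let cell_measurable t : measurable (cell t : set (measurableTypeR R)).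
Proof. by apply: measurableI; exact: measurable_itv. Qed.

Let cell_sub t : cell t `<=` Y. Proof. by move=> x []. Qed.

Let cell_mesh t u v : cell t u -> cell t v -> `|u - v| <= mesh.
Proof.
move=> [_ /=]; rewrite in_itv /= -natr1 => /andP[u1 u2].
move=> [_ /=]; rewrite in_itv /= -natr1 => /andP[v1 v2].
by rewrite ler_norml; apply/andP; split; lra.
Qed.

Let cell_trivIset : trivIset [set` s] cell.
Proof.
have lt i j x : (i < j)%N -> cell i x -> cell j x -> False.
  move=> ij [_ /=]; rewrite in_itv /= => /andP[_ xi].
  move=> [_ /=]; rewrite in_itv /= => /andP[xj _].
  have : j%:R * mesh < i.+1%:R * mesh.
    by rewrite -(ltrD2l a) (le_lt_trans xj).
  by rewrite ltr_pM2r// ltr_nat ltnS leqNgt ij.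
move=> i j _ _ [x [xi xj]]; apply/eqP; rewrite eqn_leq.
by apply/andP; split; rewrite leqNgt; apply/negP => ij;
  [exact: lt xj xi|exact: lt xi xj].
Qed.

Let cell_cover : \big[setU/set0]_(t <- s) cell t = Y.
Proof.
rewrite -bigcup_seq; apply/seteqP; split => [x [t _ /cell_sub//]|x Yx].
move: (Yx); rewrite /Y /= in_itv /= => /andP[ax xb].
have q0 : 0 <= (x - a) / mesh by rewrite divr_ge0 ?subr_ge0// ltW.
have /andP[t1 t2] := truncn_itv q0.
exists (Num.truncn ((x - a) / mesh)); last first.
  split => //=; rewrite in_itv /=; apply/andP; split.
    by rewrite -lerBrDl -ler_pdivlMr.
  by rewrite -ltrBlDl -ltr_pdivrMr.
rewrite /= mem_iota /= add0n ltnS -(ler_nat R) (le_trans t1)//.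
rewrite ler_pdivrMr// /mesh mulrC divfK ?pnatr_eq0//.
by rewrite lerD2r.
Qed.

Let integral_cells (h : R -> R) : mu.-integrable Y (EFin \o h) ->
  \int[mu]_(x in Y) h x = \sum_(t <- s) \int[mu]_(x in cell t) h x.
Proof.
move=> hi; rewrite {1}/Rintegral -cell_cover integral_bigsetU_EFin//.
- rewrite -sum_fine// => t _; apply: integrable_fin_num => //.
  exact: integrableS hi.
- exact: iota_uniq.
- by rewrite cell_cover; exact: measurable_int hi.
Qed.

(** Cutting the segment into cells of length at most mesh and choosing in each
    one a point where J is at most e above its average over the cell keeps the
    discrete mean of J close to or below its integral, and integrates functions
    with a small modulus of continuity accurately. *)
Lemma quadrature (J : R -> R) (e : R) : 0 < e -> mu.-integrable Y (EFin \o J) ->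
  exists w y : nat -> R,
  [/\ forall t, 0 <= w t /\ Y (y t),
      \sum_(t < N.+2) w t = fine (mu Y),
      \sum_(t < N.+2) w t * J (y t) <= \int[mu]_(x in Y) J x + e * fine (mu Y) &
      forall (h : R -> R) (c : R), mu.-integrable Y (EFin \o h) ->
        (forall u v, Y u -> Y v -> `|u - v| <= mesh -> `|h u - h v| <= c) ->
        `|\sum_(t < N.+2) w t * h (y t) - \int[mu]_(x in Y) h x| <=
          c * fine (mu Y)].
Proof.
move=> e0 Ji.
have cellS t h : mu.-integrable Y (EFin \o h) -> mu.-integrable (cell t) (EFin
  \o h).
  by move=> hi; exact: integrableS hi.
have /choice[y yP] t := point_below_average (cell_measurable t) (@cell_sub t) e0
  (cellS t _ Ji).
pose w t := fine (mu (cell t)).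
have toord (F : nat -> R) : \sum_(t < N.+2) F t = \sum_(t <- s) F t :> R.
  by rewrite -(big_mkord xpredT F) /index_iota subn0.
have wsum : \sum_(t <- s) w t = fine (mu Y).
  have := integral_cells (cst_integrable mu 1 mY);
    rewrite Rintegral_cst// mul1r => ->.
  by apply: eq_bigr => t _; rewrite Rintegral_cst// mul1r.
exists w, y; split.
- by move=> t; split; [apply: fine_ge0; exact: measure_ge0|case: (yP t)].
- by rewrite toord.
- rewrite (toord (fun t => w t * J (y t))) (integral_cells Ji) -wsum mulr_sumr
  -big_split.
  by apply: ler_sum => t _; case: (yP t).
- move=> h c hi hc; rewrite (toord (fun t => w t * h (y t))) (integral_cells
  hi) -wsum -sumrB mulr_sumr.
  apply: (le_trans (ler_norm_sum _ _ _)); apply: ler_sum => t _.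
  have [Ce|/set0P C0] := eqVneq (cell t) set0.
    by rewrite /w Ce measure0 /= mul0r mulr0 Rintegral_set0 subrr normr0.
  have [Yy /(_ C0) Cy _] := yP t.
  have close x : cell t x -> `|h (y t) - h x| <= c.
    by move=> Cx; apply: hc => //; [exact: cell_sub Cx|exact: cell_mesh Cy Cx].
  have hi' := cellS t h hi.
  have up : \int[mu]_(x in cell t) h x <= (h (y t) + c) * w t.
    rewrite -Rintegral_cst//; apply: le_Rintegral => //;
      first exact: cst_integrable.
    by move=> x /close; rewrite ler_norml => /andP[]; lra.
  have lo : (h (y t) - c) * w t <= \int[mu]_(x in cell t) h x.
    rewrite -Rintegral_cst//; apply: le_Rintegral => //;
      first exact: cst_integrable.
    by move=> x /close; rewrite ler_norml => /andP[]; lra.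
  by rewrite ler_norml; apply/andP; split; lra.
Qed.

End Cells.

End Quadrature.
(** * The averaging functional over minimisers *)

Section UltrafilterLimits.
Context {R : realType}.

Lemma ultra_image (S T : Type) (U : set_system S) (u : S -> T) :
  UltraFilter U -> UltraFilter (u @ U).
Proof.
move=> UU; split=> [|G GG UG]; first exact: fmap_proper_filter.
apply/seteqP; split=> // A GA.
have [//|UnA] := in_ultra_setVsetC (u @^-1` A) UU.
have : G (A `&` ~` A) by apply: filterI => //; exact: UG.
by rewrite setICr => /filter_not_empty.
Qed.

(** Along an ultrafilter all bounded families converge at once, which makes the
    limit of linear functionals linear. *)
Lemma bounded_ultra_cvg (S : Type) (U : set_system S) (u : S -> R) (B : R) :
  UltraFilter U -> (forall i, `|u i| <= B) -> cvg (u @ U).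
Proof.
move=> UU uB; have cB : compact (`[- B, B]%classic : set R).
  exact: segment_compact.
have := cB; rewrite compact_ultra => /(_ _ (ultra_image u UU))[|l [_ ul]].
  apply: nearW => i /=; rewrite in_itv /= -ler_norml; exact: uB.
by apply/cvg_ex; exists l.
Qed.

End UltrafilterLimits.

Section PowerModulus.
Context {R : realType}.

Lemma power_lipschitz_on (B : R) (l : nat) : exists2 c : R, 0 <= c &
  forall u v, `|u| <= B -> `|v| <= B -> `|u ^+ l - v ^+ l| <= c * `|u - v|.
Proof.
elim: l => [|l [c c0 IH]].
  by exists 0 => // u v _ _; rewrite !expr0 subrr normr0 mul0r.
exists (`|B| * c + `|B| ^+ l); first by rewrite addr_ge0 ?mulr_ge0 ?exprn_ge0.
move=> u v uB vB.
have uB' := le_trans uB (ler_norm B); have vB' := le_trans vB (ler_norm B).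
have -> : u ^+ l.+1 - v ^+ l.+1 = u * (u ^+ l - v ^+ l) + v ^+ l * (u - v).
  by rewrite !exprS; ring.
rewrite (le_trans (ler_normD _ _))// mulrDl lerD//.
  by rewrite normrM -mulrA ler_pM// IH.
by rewrite normrM normrX ler_wpM2r// lerXn2r// nnegrE.
Qed.

End PowerModulus.

Lemma meval_continuous {R : realType} {n : nat} (p : {mpoly R[n]}) :
  continuous (fun x : 'rV[R]_n => p.@[x ord0]).
Proof.
rewrite (_ : (fun x => _) = fun x : 'rV[R]_n =>
    \sum_(e <- msupp p) p@_e * \prod_i x ord0 i ^+ e i); last first.
  by apply/funext => x; rewrite mevalE.
apply: continuous_big => [|e _ x]; first exact: add_continuous.
apply: continuousM; first exact: cst_continuous.
move: x; apply: continuous_big => [|i _ x]; first exact: mul_continuous.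
apply: (@continuous_comp _ _ _ (fun x : 'rV[R]_n => x ord0 i) (fun t => t ^+ e
  i)).
  exact: coord_continuous.
exact: exprn_continuous.
Qed.

Section MeanFunctional.
Context {R : realType} {n : nat}.
Context (mu : {finite_measure set (measurableTypeR R) -> \bar R}).
Context (a b : R) (ab : a < b).
Let Y : set R := `[a, b]%classic.
Context (K : set 'rV[R]_n) (K_compact : compact K).
Context (f : {mpoly R[n]}) (k : 'I_n) (J : R -> R).
Hypothesis fiberwise_min_attained : forall y, Y y ->
  exists x, [/\ K x, x ord0 k = y & f.@[x ord0] = J y].

(** The limit, along an ultrafilter finer than the cofinite one, of discrete
    averages over minimisers in finitely many fibers.  Their marginals tend to
    mu and their values at f exceed the integral of J by an amount that tends
    to 0. *)
Lemma mean_functional : mu.-integrable Y (EFin \o J) ->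
  exists L : {scalar {mpoly R[n]}},
  [/\ forall h, (forall x, K x -> 0 <= h.@[x ord0]) -> 0 <= L h,
      forall l, L ('X_k ^+ l) = \int[mu]_(y in Y) (y ^+ l) &
      L f <= \int[mu]_(y in Y) J y].
Proof.
move=> Ji; pose M := fine (mu Y).
have M0 : 0 <= M by apply: fine_ge0; exact: measure_ge0.
have Ya : Y a by rewrite /Y /= in_itv /= lexx ltW.
have /choice[xi xiP] y : exists x, Y y ->
    [/\ K x, x ord0 k = y & f.@[x ord0] = J y].
  have [Yy|nYy] := pselect (Y y); last by exists 0.
  by have [x xP] := fiberwise_min_attained Yy; exists x.
have inv_gt0 N : 0 < N.+1%:R^-1 :> R by rewrite invr_gt0.
have /choice[w /choice[y quad]] := fun N => quadrature ab N (inv_gt0 N) Ji.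
pose LN (N : nat) (h : {mpoly R[n]}) : R :=
  \sum_(t < N.+2) w N t * h.@[xi (y N t) ord0].
have w_ge0 N t : 0 <= w N t by have [/(_ t)[]] := quad N.
have Yy N t : Y (y N t) by have [/(_ t)[]] := quad N.
have Kxi N t : K (xi (y N t)) by have [] := xiP _ (Yy N t).
have LN_cvg (U : set_system nat) h : UltraFilter U -> cvg (LN ^~ h @ U).
  move=> UU; have [B hB] := compact_bound K_compact (@meval_continuous _ _ h).
  apply: (@bounded_ultra_cvg _ _ _ _ (B * M)) => N.
  apply: (le_trans (ler_norm_sum _ _ _)).
  have [_ wE _ _] := quad N; rewrite /M -wE mulr_sumr; apply: ler_sum => t _.
  by rewrite normrM (ger0_norm (w_ge0 _ _)) mulrC ler_wpM2r// hB.
have [U [UU oo_U]] := ultraFilterLemma (eventually_filter : ProperFilter \oo).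
pose L0 h := lim (LN ^~ h @ U).
have L0P h : LN ^~ h @ U --> L0 h by exact: LN_cvg.
have L0E h l : LN ^~ h @ \oo --> l -> L0 h = l.
  move=> hl; apply: cvg_lim => //; apply: cvg_trans hl.
  exact: (cvg_app (LN ^~ h) oo_U).
have L0_scalar : scalar L0.
  move=> c p q; apply: cvg_lim => //.
  have -> : LN ^~ (c *: p + q) = (fun N => c * LN N p + LN N q).
    apply/funext => N; rewrite /LN mulr_sumr -big_split; apply: eq_bigr => t _.
    by rewrite mevalD mevalZ /=; ring.
  by apply: cvgD => //; apply: cvgMl_tmp.
pose L : {scalar {mpoly R[n]}} :=
  HB.pack L0 (GRing.isLinear.Build R {mpoly R[n]} R *%R L0 L0_scalar).
exists L; split=> [h h0|l|].
- apply: limr_ge; first exact: L0P.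
  by apply: nearW => N; apply: sumr_ge0 => t _; rewrite mulr_ge0// h0.
- apply: L0E; apply/cvgrPdist_le => e e0.
  pose B := Num.max `|a| `|b|; have [c c0 cP] := power_lipschitz_on B l.
  have YB u : Y u -> `|u| <= B.
    rewrite /Y /= in_itv /= => /andP[au ub]; rewrite /B.
    have := ler_norm (- a); have := ler_norm b; rewrite normrN => hb ha.
    have : `|a| <= Num.max `|a| `|b| by rewrite le_max lexx.
    have : `|b| <= Num.max `|a| `|b| by rewrite le_max lexx orbT.
    by move=> *; rewrite ler_norml; apply/andP; split; lra.
  near=> N.
  have [_ _ _ Q] := quad N.
  have E : LN N ('X_k ^+ l) = \sum_(t < N.+2) w N t * (y N t) ^+ l.
    apply: eq_bigr => t _; rewrite rmorphXn /= mevalXU.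
    by have [_ -> _] := xiP _ (Yy N t).
  rewrite distrC E (le_trans (Q (fun x => x ^+ l) (c * ((b - a) / N.+1%:R)) _
    _))//.
  + apply: continuous_segment_integrable; exact: exprn_continuous.
  + move=> u v Yu Yv uv; rewrite (le_trans (cP _ _ (YB _ Yu) (YB _ Yv)))//.
    by rewrite ler_wpM2l.
  + rewrite mulrA mulrAC ler_pdivrMr// -ler_pdivrMl// -natr1.
    by apply: (@le_trans _ _ N%:R); [near: N;
      exact: nbhs_infty_ger|rewrite lerDl].
- have LNf N : LN N f <= \int[mu]_(x in Y) J x + N.+1%:R^-1 * M.
    have [_ _ Q _] := quad N; apply: le_trans Q.
    by apply: ler_sum => t _; have [_ _ ->] := xiP _ (Yy N t).
  apply/ler_addgt0Pl => e e0; apply: limr_le; first exact: L0P.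
  apply: oo_U; near=> N; rewrite (le_trans (LNf N))// addrC lerD2r.
  rewrite mulrC ler_pdivrMr// -ler_pdivrMl// -natr1.
  by apply: (@le_trans _ _ N%:R); [near: N;
    exact: nbhs_infty_ger|rewrite lerDl].
Unshelve. all: by end_near. Qed.

End MeanFunctional.

(** * Polynomials in one coordinate *)

Section EvaluationOfUnivariate.
Context {R : realType} {n : nat} (k : 'I_n).

Lemma horner_alg_coef (p : {poly R}) :
  horner_alg 'X_k p = \sum_(l < size p) p`_l *: 'X_k ^+ l :> {mpoly R[n]}.
Proof.
rewrite -{1}[p]coefK poly_def linear_sum; apply: eq_bigr => l _.
by rewrite linearZ /= rmorphXn /= horner_algX mulr_algl.
Qed.

Lemma meval_horner_alg (p : {poly R}) (x : 'I_n -> R) :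
  (horner_alg 'X_k p : {mpoly R[n]}).@[x] = p.[x k].
Proof.
rewrite horner_alg_coef horner_coef linear_sum; apply: eq_bigr => l _ /=.
by rewrite mevalZ rmorphXn /= mevalXU.
Qed.

End EvaluationOfUnivariate.

Section UniformIntegral.
Context {R : realType} (xl xu : R) (xlu : xl < xu).

Lemma uniform_integralE (p : {poly R}) :
  uniform_integral xlu p =
  (\int[uniform_prob xlu]_(x in `[xl, xu]) p.[x])%:E.
Proof.
rewrite /Rintegral fineK//; apply: integrable_fin_num.
  exact: measurable_segment.
exact: (poly_integrable (uniform_prob xlu) xl xu p).
Qed.

Lemma uniform_integral_moments (p : {poly R}) :
  \int[uniform_prob xlu]_(x in `[xl, xu]) p.[x] =
  \sum_(l < size p) p`_l * uniform_moment xlu l.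
Proof.
have mY := measurable_segment xl xu.
have powi (l : nat) : (uniform_prob xlu).-integrable `[xl, xu]%classic
    (EFin \o (fun x => x ^+ l)).
  apply: (continuous_segment_integrable (uniform_prob xlu)).
  exact: exprn_continuous.
under eq_Rintegral do rewrite horner_coef.
move: (polyseq p) => c; elim: (size c) => [|N IH].
  rewrite big_ord0; under eq_Rintegral do rewrite big_ord0.
  by rewrite Rintegral_cst// mul0r.
rewrite [LHS](eq_Rintegral (uniform_prob xlu)
  (g := fun x => \sum_(i < N) c`_i * x ^+ i + c`_N * x ^+ N)); last first.
  by move=> x _; rewrite big_ord_recr.
rewrite RintegralD//.
- by rewrite IH RintegralZl// big_ord_recr.
- have -> : (fun x : R => \sum_(i < N) c`_i * x ^+ i) = horner (\poly_(i < N)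
  c`_i).
    by apply/funext => x; rewrite horner_poly.
  exact: (poly_integrable (uniform_prob xlu) xl xu).
- exact: (integrableZl mY c`_N (powi N)).
Qed.

Lemma riesz_univariate {n m : nat} (g : 'I_m -> {mpoly R[n]}) (k : 'I_n) i z
    (p : {poly R}) : primal_feasible g k xlu (i := i) z ->
  (size p <= (2 * i).+1)%N ->
  riesz z (horner_alg 'X_k p) = \int[uniform_prob xlu]_(x in `[xl, xu]) p.[x].
Proof.
move=> [_ _ zX] pi; rewrite uniform_integral_moments horner_alg_coef linear_sum.
apply: eq_bigr => l _; rewrite linearZ /= zX//.
by rewrite -ltnS (leq_trans _ pi).
Qed.

End UniformIntegral.

(** * The minimum of f over the fibers of K *)

Section SemialgebraicFibers.
Context {R : realType} {n m : nat}.
Context (f : {mpoly R[n]}) (g : 'I_m -> {mpoly R[n]}) (k : 'I_n).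
Hypothesis K_compact : compact (semialg g).

(** [set_min] takes its default value only if no minimum is attained, which is
    excluded by compactness of the fiber. *)
Lemma fiber_minP (y : R) : semialg_fiber g k y !=set0 ->
  exists2 x, semialg_fiber g k y x & f.@[x ord0] = fiber_min f g k y /\
    forall z, semialg_fiber g k y z -> fiber_min f g k y <= f.@[z ord0].
Proof.
move=> F0; have cF : compact (semialg_fiber g k y).
  apply: compact_closedI => //.
  apply: (@preimage_closed _ _ (fun x : 'rV[R]_n => x ord0 k) [set y]).
    by move=> x _; exact: coord_continuous.
  exact: closed_eq.
have [c /set_mem Fc cP] := compact_EVT_min F0 cF
  (continuous_subspaceT (@meval_continuous _ _ f)).
suff <- : f.@[c ord0] = fiber_min f g k y.
  by exists c => //; split=> // z Fz; apply: cP; rewrite inE.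
rewrite /fiber_min /set_min; case: xgetP => [t _ [[x Fx <-] lb]|no].
  by apply/eqP; rewrite eq_le cP ?inE//=; apply: lb; exists c.
exfalso; apply: (no f.@[c ord0]); split; first by exists c.
by move=> _ [x Fx <-]; apply: cP; rewrite inE.
Qed.

End SemialgebraicFibers.

(** * Running maxima and convergence almost everywhere *)

Lemma cvge_squeeze_eps (R : realType) (u : nat -> \bar R) (l : R) :
  (\forall i \near \oo, (u i <= l%:E)%E) ->
  (forall e : R, 0 < e -> \forall i \near \oo, ((l - e)%:E <= u i)%E) ->
  u i @[i --> \oo] --> l%:E.
Proof.
move=> ub lb; apply/fine_cvgP; split.
  near=> i; rewrite fin_numElt; apply/andP; split.
    apply: (@lt_le_trans _ _ (l - 1)%:E); first exact: ltNyr.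
    by near: i; exact: lb.
  apply: (@le_lt_trans _ _ l%:E); last exact: ltry.
  by near: i; exact: ub.
apply/cvgrPdist_le => e e0; near=> i.
have u1 : (u i <= l%:E)%E by near: i; exact: ub.
have u2 : ((l - e)%:E <= u i)%E by near: i; exact: lb.
move: u1 u2; rewrite /comp; case: (u i) => [r| |]//=.
by rewrite !lee_fin => r1 r2; rewrite ger0_norm ?subr_ge0//; lra.
Unshelve. all: by end_near. Qed.

Section RunningMaximum.
Context {R : realType} (p : nat -> {poly R}) (i1 : nat).

Lemma running_max_le_start i y : (i <= i1)%N -> running_max p i1 i y = (p
  i1).[y].
Proof. by case: i => //= i ->. Qed.

Lemma running_max_nondecreasing i j y : (i <= j)%N ->
  running_max p i1 i y <= running_max p i1 j y.
Proof.
move=> /subnKC <-; elim: (j - i)%N => [|d IH]; first by rewrite addn0.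
rewrite addnS (le_trans IH)//=; case: ifP => [id|_];
  last by rewrite le_max lexx.
by rewrite running_max_le_start// ltnW.
Qed.

Lemma le_running_max i y : (i1 <= i)%N -> (p i).[y] <= running_max p i1 i y.
Proof.
case: i => [|i] i1i /=; first by move: i1i; rewrite leqn0 => /eqP ->.
case: ifP => [ii1|_]; last by rewrite le_max lexx orbT.
by have -> : i1 = i.+1 by apply/eqP; rewrite eqn_leq i1i.
Qed.

Lemma running_max_le (c : R) i y : (forall i, (i1 <= i)%N -> (p i).[y] <= c) ->
  running_max p i1 i y <= c.
Proof.
move=> pc; elim: i => [|i IH] /=; first exact: pc.
case: ifP => [_|ii1]; first exact: pc.
by rewrite ge_max IH pc// leqW// leqNgt ii1.
Qed.

Lemma running_max_measurable (D : set (measurableTypeR R)) i :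
  measurable_fun D (running_max p i1 i).
Proof.
have mp (q : {poly R}) : measurable_fun D (fun x => q.[x]).
  exact: measurable_poly.
elim: i => [|i IH]; first exact: mp.
rewrite (_ : running_max p i1 i.+1 = if (i < i1)%N then fun y => (p i1).[y]
  else fun y => Num.max (running_max p i1 i y) (p i.+1).[y]).
  by case: ifP => _; [exact: mp|exact: measurable_maxr].
by apply/funext => y /=; case: ifP.
Qed.

End RunningMaximum.

Section L1Squeeze.
Context {R : realType}.
Context (mu : {finite_measure set (measurableTypeR R) -> \bar R}).
Context (D : set (measurableTypeR R)) (mD : measurable D).
Context (J : R -> R) (J_int : mu.-integrable D (EFin \o J)).

Lemma integral_gap (h : R -> R) : mu.-integrable D (EFin \o h) ->
  (forall y, D y -> h y <= J y) ->
  (\int[mu]_(y in D) `|J y - h y|%:E)%E =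
  (\int[mu]_(y in D) J y - \int[mu]_(y in D) h y)%:E.
Proof.
move=> hi hJ; rewrite -RintegralB// /Rintegral fineK; last first.
  by apply: integrable_fin_num => //; exact: (integrableB mD J_int hi).
apply: eq_integral => y /set_mem Dy; rewrite ger0_norm// subr_ge0; exact: hJ.
Qed.

(** The monotone limit of u lies between the q i and J, so it has the integral
    of J; being at most J, it equals J almost everywhere. *)
Lemma ae_cvg_of_integral (u : nat -> R -> R) (q : nat -> R -> R) (N : nat) :
  (forall i, measurable_fun D (u i)) ->
  (forall i, mu.-integrable D (EFin \o q i)) ->
  (forall i j y, (i <= j)%N -> u i y <= u j y) ->
  (forall i y, (N <= i)%N -> q i y <= u i y) ->
  (forall i y, D y -> u i y <= J y) ->
  (fun i => \int[mu]_(y in D) q i y) @ \oo --> \int[mu]_(y in D) J y ->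
  {ae mu, forall y, D y -> (fun i => u i y) @ \oo --> J y}.
Proof.
move=> mu_u qi und qu uJ qJ.
pose Q y := limn (fun i => u i y).
have uQ y : D y -> (fun i => u i y) @ \oo --> Q y.
  move=> Dy; apply: nondecreasing_is_cvgn.
    by move=> i j ij; exact: und.
  by exists (J y) => _ [i _ <-]; exact: uJ.
have mQ : measurable_fun D Q by exact: (measurable_fun_cvg mu_u uQ).
have uleQ i y : D y -> u i y <= Q y.
  move=> Dy; apply: (nondecreasing_cvgn_le _ (uQ y Dy)).
  by move=> a b ab; exact: und.
have QleJ y : D y -> Q y <= J y.
  move=> Dy; apply: limr_le; first exact: uQ.
  by apply: nearW => i; exact: uJ.
have mJ := measurable_int mu J_int.
have mg : measurable_fun D (fun y => (J y - Q y)%:E).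
  by apply/measurable_EFinP; apply: measurable_funB => //;
    apply/measurable_EFinP.
have int0 : (\int[mu]_(y in D) `|(J y - Q y)%:E| = 0)%E.
  apply/eqP; rewrite eq_le integral_ge0// andbT; apply/lee_addgt0Pr => e e0.
  rewrite add0e.
  have /cvgrPdist_le/(_ e e0)[M _ MP] := qJ.
  pose i := maxn M N.
  apply: (@le_trans _ _ (\int[mu]_(y in D) `|J y - q i y|%:E)%E).
    apply: ge0_le_integral => //.
    - exact: measurableT_comp.
    - apply/measurable_EFinP; apply: measurableT_comp => //.
      apply: measurable_funB; apply/measurable_EFinP => //.
      exact: measurable_int (qi i).
    - move=> y Dy; rewrite /= lee_fin.
      have := uleQ i y Dy; have := QleJ y Dy.
      have := qu i y (leq_maxr _ _) => h1 h2 h3.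
      rewrite !ger0_norm ?subr_ge0//;
        last by rewrite (le_trans h1)// (le_trans h3).
      by rewrite lerD2l lerN2 (le_trans h1).
  rewrite integral_gap//; last first.
    by move=> y Dy; rewrite (le_trans (qu i y (leq_maxr _ _)))// uJ.
  by rewrite lee_fin (le_trans (ler_norm _))//; apply: MP; exact: leq_maxl.
have /ae_eq_integral_abs := int0.
move=> /(_ mD mg); apply: filterS => y JQ Dy.
have JQ0 : (J y - Q y)%:E = 0%:E := JQ Dy.
by rewrite (subr0_eq (EFin_inj JQ0)); exact: uQ.
Qed.

End L1Squeeze.

(** * Bounds on the values of the relaxations *)

Section Bounds.
Context {R : realType} {n m : nat}.
Context (f : {mpoly R[n]}) (g : 'I_m -> {mpoly R[n]}) (k : 'I_n).
Context (xl xu : R) (xlu : xl < xu).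
Hypothesis K_compact : compact (semialg g).
Hypothesis proj_K : [set x ord0 k | x in semialg g] = `[xl, xu]%classic.

Let phi := uniform_prob xlu.
Let Y : set R := `[xl, xu]%classic.
Let J := fiber_min f g k.
Let mY := measurable_segment xl xu.

Let fiber_nonempty (y : R) : Y y -> semialg_fiber g k y !=set0.
Proof. by rewrite /Y -proj_K => -[x Kx xy]; exists x. Qed.

Let J_attained (y : R) : Y y ->
  exists x, [/\ semialg g x, x ord0 k = y & f.@[x ord0] = J y].
Proof. by move=> /fiber_nonempty/(fiber_minP f K_compact)[x [Kx xy] [fx _]];
  exists x. Qed.

Let J_le (x : 'rV[R]_n) : semialg g x -> J (x ord0 k) <= f.@[x ord0].
Proof.
move=> Kx; have Fx : semialg_fiber g k (x ord0 k) x by [].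
have [_ _ [_ lb]] := fiber_minP f K_compact (ex_intro _ x Fx).
exact: lb.
Qed.

Lemma fiber_min_integrable : phi.-integrable Y (EFin \o J).
Proof.
exact: (fiberwise_min_integrable phi xlu K_compact (@meval_continuous _ _ f)
  (@coord_continuous _ _ _ ord0 k) J_attained J_le).
Qed.

Lemma fiber_min_integralE :
  (\int[phi]_(y in Y) (J y)%:E)%E = (\int[phi]_(y in Y) J y)%:E.
Proof. by rewrite /Rintegral fineK// (integrable_fin_num mY
  fiber_min_integrable). Qed.

Lemma meval_sos_ge0 (s : {mpoly R[n]}) (x : 'I_n -> R) : sos s -> 0 <= s.@[x].
Proof.
by move=> [r ->]; rewrite linear_sum sumr_ge0// => q _;
  rewrite rmorphXn sqr_ge0.
Qed.

(** f - p(x_k) is nonnegative at a minimiser of f on the fiber over y. *)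
Lemma dual_feasible_le (i : nat) p s0 s (y : R) :
  dual_feasible f g k i p s0 s -> Y y -> p.[y] <= J y.
Proof.
move=> [_ [S0 _] S e] /J_attained[x [Kx <- <-]].
rewrite -meval_horner_alg -subr_ge0 -mevalB e mevalD linear_sum /=.
rewrite addr_ge0 ?meval_sos_ge0// sumr_ge0// => j _.
by rewrite mevalM mulr_ge0// meval_sos_ge0//; case: (S j).
Qed.

Lemma dual_value_le (i : nat) :
  (dual_value f g k xlu i <= (\int[phi]_(y in Y) J y)%:E)%E.
Proof.
apply: ge_ereal_sup => _ [p [s0 [s feas]] <-].
rewrite uniform_integralE lee_fin; apply: le_Rintegral => //.
- exact: (poly_integrable phi xl xu p).
- exact: fiber_min_integrable.
- by move=> y Yy; exact: dual_feasible_le feas Yy.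
Qed.

Lemma primal_value_le (i : nat) :
  (forall j, half_degree (g j) <= i)%N -> (mdegree f <= 2 * i)%N ->
  (primal_value f g k xlu i <= (\int[phi]_(y in Y) J y)%:E)%E.
Proof.
move=> gi fi; have [L [Lpos LX Lf]] :=
  mean_functional xlu K_compact J_attained fiber_min_integrable.
apply: (@le_trans _ _ (L f)%:E); last by rewrite lee_fin.
apply: primal_value_le_scalar => //; apply: scalar_primal_feasible => //.
- by move=> h _; apply: Lpos => x _; rewrite rmorphXn sqr_ge0.
- move=> j h _; apply: Lpos => x Kx.
  by rewrite mevalM rmorphXn mulr_ge0 ?sqr_ge0//; exact: Kx.
Qed.

(** The same certificate, for a polynomial p < J with integral at least that of
    J minus e, bounds the dual value (p is feasible) and the primal value
    (feasible functionals are nonnegative on the certificate). *)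
Lemma values_eventually_ge (c e : R) :
  quadratic_module_of g (c%:MP - \sum_(l < n) 'X_l ^+ 2) -> 0 < e ->
  \forall i \near \oo,
    ((\int[phi]_(y in Y) J y - e)%:E <= dual_value f g k xlu i)%E /\
    ((\int[phi]_(y in Y) J y - e)%:E <= primal_value f g k xlu i)%E.
Proof.
move=> arch e0.
have [p [pJ pint]] := poly_below_fiberwise_min phi xlu K_compact
  (@meval_continuous _ _ f) (@coord_continuous _ _ _ ord0 k) J_attained J_le e0.
have [|N NP] := @certificate_eventually _ _ _ f g k xl xu xlu p.
  apply: putinar arch _ => x Kx; rewrite mevalB meval_horner_alg subr_gt0.
  apply: (lt_le_trans (pJ _ _)); last exact: J_le.
  by rewrite -proj_K; exists x.
exists N => // i /= Ni; have [[s0 [s feas]] primal] := NP i Ni.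
have pI : ((\int[phi]_(y in Y) J y - e)%:E <= uniform_integral xlu p)%E.
  by rewrite uniform_integralE lee_fin.
split.
  apply: (le_trans pI); apply: ereal_sup_ubound.
  by exists p => //; exists s0, s.
apply: le_ereal_inf_tmp => _ [z zfeas <-]; apply: (le_trans pI).
rewrite uniform_integralE lee_fin -(riesz_univariate zfeas);
  first exact: primal.
by case: feas.
Qed.

End Bounds.

Unset Implicit Arguments.

Theorem theorem2 (R : realType) (n m : nat)
  (f : {mpoly R[n]}) (g : 'I_m -> {mpoly R[n]})
  (K_compact : compact (semialg g))
  (archimedean : exists M : R, 0 < M /\
     exists (s0 : {mpoly R[n]}) (s : 'I_m -> {mpoly R[n]}),
       [/\ sos s0, (forall j, sos (s j))
         & M%:MP - \sum_(l < n) 'X_l ^+ 2 = s0 + \sum_(j < m) s j * g j])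
  (k : 'I_n) (xl xu : R) (xlu : xl < xu)
  (proj_K : [set x ord0 k | x in semialg g] = `[xl, xu]%classic)
  (fiber_nonempty : forall y : R, y \in `[xl, xu] ->
     semialg_fiber g k y !=set0)
  (i0 : nat) (i0_pos : (1 <= i0)%N)
  (i0_g : forall j, (half_degree (g j) <= i0)%N)
  (i0_f : (mdegree f <= 2 * i0)%N) :
  let phi := uniform_prob xlu in
  let Y : set R := `[xl, xu]%classic in
  let J := fiber_min f g k in
  let rho := primal_value f g k xlu in
  let rho_dual := dual_value f g k xlu in
  (* (a) *)
  [/\ forall i j : nat, (i0 <= i <= j)%N -> (rho i <= rho j)%E,
      rho i @[i --> \oo] --> (\int[phi]_(y in Y) (J y)%:E)%E,
      forall i j : nat, (i0 <= i <= j)%N -> (rho_dual i <= rho_dual j)%E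
    & rho_dual i @[i --> \oo] --> (\int[phi]_(y in Y) (J y)%:E)%E] /\
  (* (b) *)
  (forall (i1 : nat) (p : nat -> {poly R}) (s0 : nat -> {mpoly R[n]})
      (s : nat -> 'I_m -> {mpoly R[n]}),
    (i0 <= i1)%N ->
    (forall i : nat, (i1 <= i)%N ->
       exists p' s0' s', dual_feasible f g k i p' s0' s') ->
    (forall i : nat, (i1 <= i)%N ->
       dual_feasible f g k i (p i) (s0 i) (s i) /\
       (rho_dual i - (i%:R^-1)%:E <= uniform_integral xlu (p i))%E) ->
    [/\ forall (i : nat) (y : R), (i1 <= i)%N -> Y y -> (p i).[y] <= J y,
        (\int[phi]_(y in Y) `|J y - (p i).[y]|%:E)%E @[i --> \oo] --> 0%E,
        {ae phi, forall y, Y y ->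
           (forall i j : nat, (i1 <= i <= j)%N ->
              running_max p i1 i y <= running_max p i1 j y) /\
           running_max p i1 i y @[i --> \oo] --> J y}
      & almost_uniform_cvg phi Y (running_max p i1) J]).
Proof.
move=> phi Y J rho rho_dual.
have [M [_ [s0A [sA [S0A SA eA]]]]] := archimedean.
have archM : quadratic_module_of g (M%:MP - \sum_(l < n) 'X_l ^+ 2).
  by exists s0A, sA.
have mY : measurable (Y : set (measurableTypeR R)) := measurable_segment xl xu.
have Jint : phi.-integrable Y (EFin \o J) :=
  fiber_min_integrable f xlu K_compact proj_K.
have lower (e : R) (e0 : 0 < e) :=
  values_eventually_ge f xlu K_compact proj_K archM e0.
have half_le i j : (i0 <= i)%N -> (half_degree (g j) <= i)%N.
  by move=> ii; exact: leq_trans (i0_g j) ii.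
have f_le i : (i0 <= i)%N -> (mdegree f <= 2 * i)%N.
  by move=> ii; rewrite (leq_trans i0_f)// leq_mul2l ii orbT.
rewrite (fiber_min_integralE f xlu K_compact proj_K).
split.
  split.
  - move=> i j /andP[i0i ij]; apply: primal_value_nondecreasing => //.
      by move=> j'; exact: half_le.
    exact: f_le.
  - apply: cvge_squeeze_eps => [|e e0].
      exists i0 => // i /= i0i; apply: primal_value_le => //.
        by move=> j'; exact: half_le.
      exact: f_le.
    by apply: filterS (lower e e0) => i [].
  - by move=> i j /andP[_ ij]; exact: dual_value_nondecreasing.
  - apply: cvge_squeeze_eps => [|e e0].
      by apply: nearW => i; exact: dual_value_le.
    by apply: filterS (lower e e0) => i [].
move=> i1 p s0 s i01 _ popt.
have pJ i y : (i1 <= i)%N -> Y y -> (p i).[y] <= J y.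
  move=> i1i; have [feas _] := popt i i1i.
  exact: dual_feasible_le feas.
have pint i : phi.-integrable Y (EFin \o (fun y => (p i).[y])).
  exact: (poly_integrable phi xl xu (p i)).
have pcvg : (fun i => \int[phi]_(y in Y) (p i).[y]) @ \oo -->
    \int[phi]_(y in Y) J y.
  apply/cvgrPdist_le => e e0; have e2 : 0 < e / 2 by rewrite divr_gt0.
  have sum_le (u v r : R) : u - e / 2 <= v + r -> r <= e / 2 -> u - v <= e by
    lra.
  near=> i.
  have i1i : (i1 <= i)%N by near: i; exact: nbhs_infty_ge.
  have [_] := popt i i1i; rewrite uniform_integralE leeBlDr// => opt.
  have low : ((\int[phi]_(y in Y) J y - e / 2)%:E <= rho_dual i)%E.
    by near: i; apply: filterS (lower _ e2) => i [].
  have inv : i%:R^-1 <= e / 2.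
    have ei : (e / 2)^-1 <= i%:R by near: i; exact: nbhs_infty_ger.
    have i_gt0 : 0 < i%:R :> R by rewrite (lt_le_trans _ ei)// invr_gt0.
    by rewrite -[e / 2]invrK lef_pV2// posrE invr_gt0.
  have up : \int[phi]_(y in Y) (p i).[y] <= \int[phi]_(y in Y) J y.
    by apply: le_Rintegral => // y Yy; exact: pJ.
  rewrite ger0_norm ?subr_ge0//.
  by apply: sum_le inv; have := le_trans low opt; rewrite -EFinD lee_fin.
have rmJ i y : Y y -> running_max p i1 i y <= J y.
  by move=> Yy; apply: running_max_le => j i1j; exact: pJ.
have rmcvg : {ae phi, forall y, Y y ->
    (fun i => running_max p i1 i y) @ \oo --> J y}.
  apply: (@ae_cvg_of_integral _ phi Y mY J Jint (running_max p i1)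
    (fun i y => (p i).[y]) i1) => //.
  - by move=> i; exact: running_max_measurable.
  - by move=> i j y; exact: running_max_nondecreasing.
  - by move=> i y; exact: le_running_max.
split=> //.
- have gap i : (i1 <= i)%N -> (\int[phi]_(y in Y) `|J y - (p i).[y]|%:E)%E =
      (\int[phi]_(y in Y) J y - \int[phi]_(y in Y) (p i).[y])%:E.
    by move=> i1i; apply: integral_gap => // y Yy; exact: pJ.
  apply/fine_cvgP; split.
    by exists i1 => // i /= i1i; rewrite gap.
  apply/cvgrPdist_le => e e0; near=> i.
  have i1i : (i1 <= i)%N by near: i; exact: nbhs_infty_ge.
  rewrite /comp gap//= sub0r normrN; near: i.
  by move/cvgrPdist_le : pcvg; apply.
- have phi_ae : Filter (almost_everywhere phi).
    exact: (ae_filter_ringOfSetsType (uniform_prob xlu)).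
  apply: filterS rmcvg => y h Yy; split; last exact: h.
  by move=> i j /andP[_ ij]; exact: running_max_nondecreasing.
- move=> eps eps0.
  have Yfin : (phi Y < +oo)%E by rewrite ltey_eq fin_num_measure.
  have [B [mB Beps Bunif]] := ae_pointwise_almost_uniform
    (fun i => @running_max_measurable _ p i1 Y i)
    (proj1 (measurable_EFinP _ _) (measurable_int phi Jint)) mY Yfin rmcvg eps0.
  exists (B `&` Y); split.
  + exact: measurableI.
  + by move=> y [_].
  + apply: le_lt_trans Beps; apply: le_measure; rewrite ?inE//.
    exact: measurableI.
  + by rewrite setDIr setDv setU0; exact: Bunif.
Unshelve. all: by end_near. Qed.
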